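(* Let $J=(0,\infty)$ and $P(s)=\ln s$ for all $s\in J$. Let $A:U_\infty\to\mathcal M^{n\times n}_{\rm sym}$, $K:U_\infty\to\mathcal M^{n\times n}$ and $B:U_\infty\times J\to\mathbb R^n$ be such that, for some constants $c_0>0$, $M_1>0$, $c_1\ge0$, $c_2\ge0$ and for all $(x,t)\in U_\infty$, $\xi\in\mathbb R^n$, $$\xi^{\rm T}A(x,t)\xi\ge c_0|\xi|^2,\qquad{\rm Tr}(A(x,t))\le M_1,\qquad -c_1|\xi|^2\le\xi^{\rm T}K(x,t)\xi\le c_2|\xi|^2 .$$ Let $u\in C(\overline{U_\infty})\cap C^{2,1}_{x,t}(U_\infty)$, with $u(U_\infty)\subset J$, be a solution of the problem $$Lu=f\ \text{ in }U\times(0,\infty),\qquad u=g\ \text{ on }\Gamma\times(0,\infty),\qquad u(x,0)=u_0(x)\ \text{ in }U,$$ where $f:U_\infty\to\mathbb R$, $g:\Gamma\times(0,\infty)\to\mathbb R$, $u_0:U\to\mathbb R$ are given functions. Assume: (a) There is a continuous, increasing function $\bar b:[0,\infty)\to[0,\infty)$ which tends to infinity as $t\to\infty$, and a number $\gamma_0>0$ such that $|B(x,t,s)|\le\bar b(t)(1+|s|)^{\gamma_0}$ for all $(x,t)\in U_\infty$ and $s\in J$. (b) There is a continuous function $F:[0,\infty)\to[0,\infty)$ such that $|f(x,t)|\le F(t)$ for all $(x,t)\in U_\infty$, and $\int_0^\infty F(\tau)\,{\rm d}\tau=\infty$. Suppose there exist a number $u_*\in J$, a positive number $\lambda_1\ge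 c_1/c_0$, and two continuous functions $\mathcal F(t)$ and $\widetilde\Lambda(t)$ defined for sufficiently large $t$ such that the following are satisfied. (i) The function $\mathcal F(t)$ is increasing and, for sufficiently large $t$, $\int_0^tF(\tau)\,{\rm d}\tau\le\mathcal F(t)$. (ii) The function $\widetilde\Lambda(t)$ is decreasing and, for sufficiently large $t$, $$\max_{(x,\tau)\in\Gamma\times[t,t+1]}|g(x,\tau)-u_*|+\int_t^{t+1}F(\tau)\mathcal F(\tau)^{\lambda_1}\,{\rm d}\tau\le\widetilde\Lambda(t).$$ (iii) For any $\mu>0$, the functions $z_0(t):=\mu\bar b(t)\mathcal F(t)^{\gamma_0}$ and $\bar\Lambda(t):=\widetilde\Lambda(t/4)$ satisfy Condition (Z) (see context) and $\limsup_{t\to\infty}\left(\bar\Lambda(t)e^{\frac{d}{c_0}z_0(t)}\right)=0$. If, additionally, $u(\overline{U_\infty})\subset[m,\infty)$ for some number $m>0$, then $$\lim_{t\to\infty}\left(\max_{x\in\bar U}|u(x,t)-u_*|\right)=0.$$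
   Context: $n\ge1$ is fixed; $U$ is a non-empty, open, bounded subset of $\mathbb R^n$ with boundary $\Gamma$, closure $\bar U$ and diameter $d=\max\{|x-x'|:x,x'\in\bar U\}$. $U_\infty=U\times(0,\infty)$, $\overline{U_\infty}=\bar U\times[0,\infty)$. $\mathcal M^{n\times n}$ (resp. $\mathcal M^{n\times n}_{\rm sym}$) is the set of real (resp. real symmetric) $n\times n$ matrices. $C^{2,1}_{x,t}(U\times I)$ is the class of continuous functions on $U\times I$ with continuous partial derivatives $\partial u/\partial t$, $\partial u/\partial x_i$, $\partial^2u/\partial x_i\partial x_j$. $\langle A,B\rangle={\rm Tr}(A^{\rm T}B)$; $D^2u$, $\nabla u$ are the Hessian and gradient in $x$. ''Increasing'', ''decreasing'', ''monotone'' are in the non-strict sense. The nonlinear operator $L$ is $$Lu=\frac{\partial u}{\partial t}-\langle A(x,t),D^2u\rangle+B(x,t,u)\cdot\nabla u+P'(u)(K(x,t)\nabla u)\cdot\nabla u.$$ Condition (Z): two nonnegative functions $z_0(t)$ and $\bar\Lambda(t)$, defined for sufficiently large $t$, satisfy Condition (Z) if there are numbers $T^*\ge0$, $t_*\ge4T^*$ and $\varepsilon_*>0$ such that $\int_{T^*}^\infty e^{-\frac{d}{c_0}z_0(x)}\,{\rm d}x=\infty$ and, for any $\varepsilon\in(0,\varepsilon_* )$, the function $$t\in[t_*,\infty)\mapsto\bar\Lambda(t)\exp\left(e^{-\frac{d^2}{2c_0}-\varepsilon}\int_{t_*}^{t+1}e^{-\frac{d}{c_0}z_0(x)}\,{\rm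 d}x\right)$$ is monotone. *)

(* Defs.v *)
From mathcomp Require Import all_boot all_order all_algebra.
From mathcomp Require Import all_classical all_reals all_analysis.
Import Order.TTheory GRing.Theory Num.Theory.
Import numFieldNormedType.Exports.

Set Implicit Arguments.
Unset Strict Implicit.
Unset Printing Implicit Defensive.

Local Open Scope classical_set_scope.
Local Open Scope ring_scope.

(* Points of R^n are column vectors.  The library norm on matrices is the sup
   norm, which is used only for the topology and boundedness; distances and
   lengths are measured with the Euclidean norm below. *)
Definition dotp (R : realType) (n : nat) (v w : 'cV[R]_n) : R :=
  \sum_(i < n) v i 0 * w i 0.

Definition enorm (R : realType) (n : nat) (v : 'cV[R]_n) : R :=
  Num.sqrt (dotp v v).

Definition mxdotp (R : realType) (n : nat) (A B : 'M[R]_n) : R :=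
  \tr (A^T *m B).

(* For a bounded nonempty U the supremum is attained. *)
Definition diam (R : realType) (n : nat) (U : set 'cV[R]_n) : R :=
  sup [set enorm (p.1 - p.2) | p in closure U `*` closure U].

Definition boundary (T : topologicalType) (U : set T) : set T :=
  closure U `\` interior U.

Definition basis_vec (R : realType) (n : nat) (i : 'I_n) : 'cV[R]_n :=
  delta_mx i 0.

(* Functions of space and time are curried and total; only their values on
   the domain of the problem are ever constrained. *)
Definition dt (R : realType) (n : nat) (u : 'cV[R]_n -> R -> R) :
    'cV[R]_n -> R -> R :=
  fun x t => derive1 (u x) t.

Definition dx (R : realType) (n : nat) (i : 'I_n) (u : 'cV[R]_n -> R -> R) :
    'cV[R]_n -> R -> R :=
  fun x t => 'D_(basis_vec R i) (u ^~ t) x.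

Definition grad (R : realType) (n : nat) (u : 'cV[R]_n -> R -> R)
    (x : 'cV[R]_n) (t : R) : 'cV[R]_n :=
  \col_i dx i u x t.

Definition hessian (R : realType) (n : nat) (u : 'cV[R]_n -> R -> R)
    (x : 'cV[R]_n) (t : R) : 'M[R]_n :=
  \matrix_(i, j) dx i (dx j u) x t.

Definition cont_on (R : realType) (n : nat) (D : set ('cV[R]_n * R))
    (u : 'cV[R]_n -> R -> R) : Prop :=
  {within D, continuous (fun p : 'cV[R]_n * R => u p.1 p.2)}.

Definition cyl (R : realType) (n : nat) (U : set 'cV[R]_n) :
    set ('cV[R]_n * R) :=
  U `*` [set t : R | 0 < t].

Definition ccyl (R : realType) (n : nat) (U : set 'cV[R]_n) :
    set ('cV[R]_n * R) :=
  closure U `*` [set t : R | 0 <= t].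

(* The existence of the partial derivatives is required separately, as the
   library operators for derivatives are total. *)
Definition C21 (R : realType) (n : nat) (U : set 'cV[R]_n)
    (u : 'cV[R]_n -> R -> R) : Prop :=
  [/\ cont_on (cyl U) u,
      (forall x t, cyl U (x, t) -> derivable (u x) t 1)
        /\ cont_on (cyl U) (dt u),
      forall i : 'I_n,
        (forall x t, cyl U (x, t) -> derivable (u ^~ t) x (basis_vec R i))
        /\ cont_on (cyl U) (dx i u)
    & forall i j : 'I_n,
        (forall x t, cyl U (x, t) ->
           derivable (dx j u ^~ t) x (basis_vec R i))
        /\ cont_on (cyl U) (dx i (dx j u))].

Definition Lop (R : realType) (n : nat) (P : R -> R)
    (A : 'cV[R]_n -> R -> 'M[R]_n) (B : 'cV[R]_n -> R -> R -> 'cV[R]_n)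
    (K : 'cV[R]_n -> R -> 'M[R]_n) (u : 'cV[R]_n -> R -> R)
    (x : 'cV[R]_n) (t : R) : R :=
  dt u x t - mxdotp (A x t) (hessian u x t)
  + dotp (B x t (u x t)) (grad u x t)
  + derive1 P (u x t) * dotp (K x t *m grad u x t) (grad u x t).

Definition monotone_from (R : realType) (a : R) (h : R -> R) : Prop :=
  (forall s t, a <= s -> s <= t -> h s <= h t)
  \/ (forall s t, a <= s -> s <= t -> h t <= h s).

(* Condition (Z) for functions z0 and Lam with respective domains Dz and DL;
   the two inclusions of rays say that everything below is evaluated where the
   functions are defined. *)
Definition condZ (R : realType) (d c0 : R) (Dz : set R) (z0 : R -> R)
    (DL : set R) (Lam : R -> R) : Prop :=
  (forall t, Dz t -> 0 <= z0 t) /\ (forall t, DL t -> 0 <= Lam t) /\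
  exists T ts eps : R,
    [/\ 0 <= T, 4 * T <= ts, 0 < eps,
        [set t : R | T <= t] `<=` Dz & [set t : R | ts <= t] `<=` DL]
    /\ (\int[lebesgue_measure]_(x in `[T, +oo[)
          (expR (- (d / c0 * z0 x)))%:E = +oo)%E
    /\ forall e, 0 < e -> e < eps ->
         monotone_from ts (fun t =>
           Lam t * expR (expR (- (d ^+ 2 / (2 * c0)) - e) *
             (\int[lebesgue_measure]_(x in `[ts, (t + 1)%R])
                expR (- (d / c0 * z0 x)))%R)).

(* Main.v *)
(* As [P' s = 1 / s], the terms of [L u] that are quadratic in the gradient get a
   favourable sign for [u `^ p] when [p = lambda1 + 1] and when
   [p = - (c2 / c0 + 1)]: both powers are subsolutions of a linear equation with
   drift [B] and source [|p u^(p-1) f|].  The maximum principle gives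
   [u <= C + int F], so the drift is at most [z0 = mu bbar Fcal^gamma0] and the
   source at most [C F Fcal^lambda1].  On a time interval [[a, a + 1]], comparison
   with the concave barrier [2 - exp (- k (x_i - l))], [k = z0 (a + 1) / c0 + 1],
   contracts the excess of [u `^ p] over its boundary values by [1 - be], where
   [be] is proportional to [rho (a + 1)], [rho = exp (- d z0 / c0)]; the source adds
   at most [C Lamt a = o (rho (a + 1))].  As the integral of [rho] diverges, the
   excess tends to [0]; a positive [p] bounds [u] from above and a negative one from
   below. *)
Require Import Defs.
From mathcomp Require Import all_boot all_order all_algebra.
From mathcomp Require Import ring lra.
From mathcomp Require Import all_classical all_reals all_analysis.
Import Order.TTheory GRing.Theory Num.Theory.
Import numFieldNormedType.Exports.

Local Open Scope classical_set_scope.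
Local Open Scope ring_scope.

Set Implicit Arguments.
Unset Strict Implicit.
Unset Printing Implicit Defensive.

(** * Quadratic forms *)

(** With [al = A grad u . grad u] and [ka = K grad u . grad u], the function [w = u^p] satisfies
    [w_t - <A, D^2 w> + B . grad w = p u^(p-1) f - p u^(p-2) ((p - 1) al + ka)]. As
    [al >= c0 |grad u|^2], the last term has the right sign when [(p - 1) c0 >= c1] for positive
    [p], which is [lambda1 >= c1 / c0] for [p - 1 = lambda1], and when [(p - 1) c0 + c2 <= 0] for
    negative [p]. The weight [Fcal^lambda1] in the hypothesis on [Lamt] is thus the factor [u^(p-1)]
    of the source; for negative [p] that factor is controlled by the lower bound [m]. The obstacle
    is a drift that grows in time: no single barrier serves for all times, and the available
    contraction degenerates. Hence the barrier is renewed on every unit interval, with [k] frozen at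
    the right end, where the drift bound is largest. Over a width [d] it loses the factor
    [exp (- k d) = exp (- d) rho], which is where the exponent [d / c0] comes from. The maximum
    principle is applied to [Phi (u)] at a maximum point, through restrictions to lines and to the
    past, so that only the given partial derivatives of [u] enter. *)

Definition qform (R : realType) (n : nat) (A : 'M[R]_n) (v : 'cV[R]_n) : R :=
  (v^T *m A *m v) 0 0.

Lemma qform_dotp (R : realType) (n : nat) (A : 'M[R]_n) (v : 'cV[R]_n) :
  dotp v (A *m v) = qform A v.
Proof.
rewrite /dotp /qform -mulmxA mxE; apply: eq_bigr => i _.
by rewrite !mxE.
Qed.

(** Induction on the size by the Schur complement: one rank-one term carries the first row and
    column, and what remains, [D - a^-1 b b^T], is again symmetric and positive definite. *)
Lemma posdef_sum_rank1 (R : realType) (n : nat) (A : 'M[R]_n) :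
  A^T = A -> (forall v : 'cV[R]_n, v != 0 -> 0 < qform A v) ->
  exists s : seq 'cV[R]_n, A = \sum_(v <- s) v *m v^T.
Proof.
elim: n A => [|n IH] A Asym Apos.
  by exists [::]; rewrite big_nil; apply/matrixP => -[].
have {IH} := IH; change 'M[R]_(1 + n) in A => IH.
pose a := A 0 0; pose b : 'cV[R]_n := dlsubmx A; pose D := drsubmx A.
have ulE : ulsubmx A = a%:M.
  apply/matrixP => i j; rewrite !ord1 mxE mxE mxE eqxx mulr1n /a.
  by congr (A _ _); apply/val_inj.
have AE : A = block_mx a%:M b^T b D.
  rewrite -[LHS]submxK ulE; congr block_mx.
  by rewrite /b trmx_dlsub Asym.
have a_gt0 : 0 < a.
  have /Apos : delta_mx 0 0 != 0 :> 'cV[R]_(1 + n).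
    by apply/eqP => /matrixP/(_ 0 0)/eqP; rewrite !mxE !eqxx oner_eq0.
  by rewrite /qform trmx_delta -rowE -colE !mxE.
have Dsym : D^T = D by rewrite /D trmx_drsub Asym.
pose A' : 'M[R]_n := D - a^-1 *: (b *m b^T).
have A'sym : A'^T = A'.
  by rewrite /A' linearB linearZ /= Dsym trmx_mul trmxK.
have A'pos v : v != 0 -> 0 < qform A' v.
  (* The first coordinate of [w] minimises the form of [A] for given [v]; the minimal value is the
     form of the Schur complement. *)
  move=> v0; pose w : 'cV[R]_(1 + n) := col_mx (- a^-1 *: (b^T *m v)) v.
  have /Apos : w != 0.
    apply: contra v0 => /eqP w0; apply/eqP.
    by have /(congr1 dsubmx) := w0; rewrite col_mxKd linear0.
  suff -> : qform A w = qform A' v by [].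
  rewrite /qform AE /w tr_col_mx mul_row_block mul_row_col /A'.
  congr (fun_of_matrix _ 0 0).
  rewrite !linearZ /= trmx_mul trmxK -scalemxAl mul_mx_scalar scalerA mulNr.
  rewrite mulVf ?gt_eqF// scaleN1r addNr mul0mx scaler0 add0r.
  rewrite mulmxDr !mulmxDl addrC -scalemxAr -!scalemxAl mulmxN mulNmx scalerN.
  by rewrite scaleNr !mulmxA.
have [s sE] := IH A' A'sym A'pos.
(* Scaled so that [c c^T] has the same first row and column as [A]. *)
pose c : 'cV[R]_(1 + n) := Num.sqrt a^-1 *: col_mx a%:M b.
exists (c :: [seq col_mx 0 v | v <- s]).
have rank1E v : col_mx 0 v *m (col_mx 0 v)^T
    = block_mx 0 0 0 (v *m v^T) :> 'M[R]_(1 + n).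
  by rewrite tr_col_mx mul_col_row trmx0 !mul0mx mulmx0.
have sumE : \sum_(v <- s) col_mx 0 v *m (col_mx 0 v)^T
    = block_mx 0 0 0 A' :> 'M[R]_(1 + n).
  rewrite sE; elim: s {sE} => [|v s IHs].
    by rewrite !big_nil block_mx_const.
  by rewrite !big_cons IHs rank1E add_block_mx !addr0.
have cE : c *m c^T
    = block_mx a%:M b^T b (a^-1 *: (b *m b^T)) :> 'M[R]_(1 + n).
  rewrite /c linearZ /= -scalemxAl -scalemxAr scalerA -expr2 sqr_sqrtr; last first.
    by rewrite invr_ge0 ltW.
  rewrite tr_col_mx mul_col_row scale_block_mx tr_scalar_mx.
  rewrite mul_scalar_mx mul_mx_scalar mul_scalar_mx !scalerA.
  by rewrite mulVf ?gt_eqF// !scale1r.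
have AcE : A = c *m c^T + \sum_(v <- s) col_mx 0 v *m (col_mx 0 v)^T.
  by rewrite sumE cE [LHS]AE add_block_mx !addr0 /A' addrC subrK.
by rewrite [LHS]AcE big_cons big_map.
Qed.

(** Once [A] is a sum of terms [v v^T], the pairing is the sum of the numbers [qform M v]. This
    turns second derivatives along lines into a bound on the elliptic term. *)
Lemma mxdotp_le0 (R : realType) (n : nat) (A M : 'M[R]_n) :
  A^T = A -> (forall v : 'cV[R]_n, v != 0 -> 0 < qform A v) ->
  (forall v, qform M v <= 0) -> mxdotp A M <= 0.
Proof.
move=> Asym Apos Mneg; have [s sE] := posdef_sum_rank1 Asym Apos.
rewrite /mxdotp Asym sE mulmx_suml raddf_sum /= -oppr_ge0 -sumrN.
apply: sumr_ge0 => v _.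
by rewrite oppr_ge0 -mulmxA mxtrace_mulC trace_mx11; exact: Mneg.
Qed.

(** * Directional derivatives and extrema *)

(** Multiplying by [h] removes the quotient: [h = 0] needs no exclusion, and errors of successive
    increments simply add up. *)
Lemma is_derive_near (R : realType) (V : normedModType R) (f : V -> R) (x v : V)
    (d : R) :
  is_derive x v f d <->
  forall e, 0 < e ->
    \forall h \near (0 : R), `|f (h *: v + x) - f x - h * d| <= e * `|h|.
Proof.
have quotE h : h != 0 -> forall e,
    (`|h^-1 *: (f (h *: v + x) - f x) - d| <= e) =
    (`|f (h *: v + x) - f x - h * d| <= e * `|h|).
  move=> h0 e; rewrite -ler_pdivrMr ?normr_gt0// -normf_div mulrBl.
  by rewrite [h * d / h]mulrAC divff// mul1r; congr (`|_ - _| <= _); rewrite mulrC.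
split=> [[df dE] e e0|H].
  have : (fun h => h^-1 *: ((f \o shift x) (h *: v) - f x)) @ 0^' --> d.
    by rewrite -dE; exact: df.
  move=> /cvgrPdist_le/(_ e e0); rewrite near_withinE; apply: filterS => h hE.
  have [->|h0] := eqVneq h 0.
    by rewrite scale0r add0r subrr sub0r mul0r normr0 mulr0 normrN normr0.
  by rewrite -quotE// distrC hE.
have cv : (fun h => h^-1 *: ((f \o shift x) (h *: v) - f x)) @ 0^' --> d.
  apply/cvgrPdist_le => e e0; rewrite near_withinE.
  move: (H e e0); apply: filterS => h hE h0.
  by rewrite distrC quotE.
apply: DeriveDef; first by apply/cvg_ex; exists d.
exact: cvg_lim cv.
Qed.

Lemma is_derive_affine (R : realType) (f : R -> R) (k s : R) :
  (forall h, f (h + s) = f s + h * k) -> is_derive s 1 f k.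
Proof.
move=> fE; apply/is_derive_near => e e0; apply/nbhs_ballP; exists 1 => //= h _.
rewrite [_ *: 1]mulr1 fE (_ : _ - _ - _ = 0); last by ring.
by rewrite normr0 mulr_ge0// ltW.
Qed.

Lemma is_derive_line (R : realType) (V : normedModType R) (f : V -> R) (x v : V)
    (s d : R) :
  is_derive (x + s *: v) v f d -> is_derive s 1 (fun r : R => f (x + r *: v)) d.
Proof.
move=> /is_derive_near H; apply/is_derive_near => e e0.
move: (H e e0); apply: filterS => h.
by rewrite [h *: 1]mulr1 scalerDl addrCA.
Qed.

(** The step [a] may have either sign, as the coordinates of a direction do, so the mean value
    theorem is used on [[0, a]] or on [[a, 0]]. *)
Lemma line_MVT (R : realType) (V : normedModType R) (f df : V -> R) (x v : V)
    (a : R) :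
  (forall s : R, `|s| <= `|a| -> is_derive (x + s *: v) v f (df (x + s *: v))) ->
  exists2 s, `|s| <= `|a| & f (x + a *: v) - f x = a * df (x + s *: v).
Proof.
move=> H; pose g r := f (x + r *: v); pose dg r := df (x + r *: v).
have gP (s : R) : `|s| <= `|a| -> is_derive s 1 g (dg s).
  by move=> sa; apply/is_derive_line/H.
have [a0|a0] := leP 0 a.
  have [||c] := @MVT_segment R g dg 0 a a0.
  - move=> s; rewrite in_itv/= => /andP[s0 sa]; apply: gP.
    by rewrite (ger0_norm (ltW s0)) (ger0_norm a0) ltW.
  - apply: derivable_within_continuous => s; rewrite in_itv/= => /andP[s0 sa].
    by have [] := gP s _; rewrite ?ger0_norm.
  - rewrite in_itv/= => /andP[c0 ca]; rewrite /g scale0r addr0 subr0 => E.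
    by exists c; [rewrite !ger0_norm|rewrite E mulrC].
have [||c] := @MVT_segment R g dg a 0 (ltW a0).
- move=> s; rewrite in_itv/= => /andP[s0 sa]; apply: gP.
  by rewrite !ltr0_norm// lerN2 ltW.
- apply: derivable_within_continuous => s; rewrite in_itv/= => /andP[s0 sa].
  by have [] := gP s _; rewrite // !ler0_norm ?lerN2// ltW.
- rewrite in_itv/= => /andP[c0 ca]; rewrite /g scale0r addr0 sub0r => E.
  exists c; first by rewrite !ler0_norm ?lerN2// ltW.
  by rewrite -opprB E mulrN opprK mulrC.
Qed.

(* The increment from [x] to [x + h xi] is split along the coordinate axes, and
   the mean value theorem is applied to each piece. *)
Lemma is_derive_partials (R : realType) (n : nat) (f : 'cV[R]_n -> R)
    (df : 'I_n -> 'cV[R]_n -> R) (x xi : 'cV[R]_n) :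
  (\forall y \near x, forall i, is_derive y (basis_vec R i) f (df i y)) ->
  (forall i, {for x, continuous (df i)}) ->
  is_derive x xi f (\sum_i xi i 0 * df i x).
Proof.
move=> dfP dfC.
(* Stated for an arbitrary list of coordinates so that they can be added one at a time. *)
suff H (r : seq 'I_n) :
    is_derive x (\sum_(i <- r) xi i 0 *: basis_vec R i) f
      (\sum_(i <- r) xi i 0 * df i x).
  have := H (index_enum 'I_n); congr is_derive.
  apply/colP => j; rewrite summxE (bigD1 j)//= !mxE !eqxx mulr1.
  rewrite big1 ?addr0// => i ij; rewrite !mxE eqxx andbT.
  by rewrite eq_sym (negbTE ij) mulr0.
elim: r => [|k r IH]; first by rewrite !big_nil; exact: is_derive0.
rewrite !big_cons; set v := \sum_(i <- r) _ in IH *.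
set d := \sum_(i <- r) _ in IH *.
apply/is_derive_near => e e0.
(* Chosen so that [|xi k 0| * e' <= e / 2]; the other half of [e] pays for the coordinates already
   treated. *)
pose e' := e / (2 * (1 + `|xi k 0|)).
have xik : 0 < 1 + `|xi k 0| by rewrite ltr_pwDl.
have e'0 : 0 < e' by rewrite divr_gt0// mulr_gt0.
have /nbhs_ballP[r0 /= r00 ballP] : \forall y \near x,
    (forall i, is_derive y (basis_vec R i) f (df i y)) /\
    `|df k x - df k y| <= e'.
  near=> y; split; first by near: y.
  near: y; have /cvgrPdist_le := dfC k; exact.
have /is_derive_near/(_ (e / 2)) := IH.
rewrite divr_gt0// => /(_ isT) IHe.
(* All intermediate points lie within [|h| * C] of [x]. *)
pose C := 1 + `|v| + `|xi k 0 *: basis_vec R k|.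
have C0 : 0 < C by rewrite /C -addrA ltr_pwDl.
near=> h.
have hv : `|f (h *: v + x) - f x - h * d| <= e / 2 * `|h| by near: h.
have hC : `|h| * C < r0.
  rewrite -ltr_pdivlMr//; near: h.
  exists (r0 / C); first by rewrite /= divr_gt0.
  by move=> h /=; rewrite sub0r normrN.
have segP (s : R) : `|s| <= `|h * xi k 0| ->
    ball x r0 (h *: v + x + s *: basis_vec R k).
  move=> sh; rewrite -ball_normE /ball_ /= addrAC opprD addrCA subrr addr0.
  rewrite normrN; apply: le_lt_trans hC.
  rewrite (le_trans (ler_normD _ _))// normrZ /C -addrA mulrDr mulrDr mulr1.
  rewrite -{1}[`|h| * `|v|]add0r -addrA lerD// lerD2l// !normrZ mulrA.
  by rewrite -normrM ler_wpM2r.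
have [s sh sE] : exists2 s, `|s| <= `|h * xi k 0| &
    f (h *: v + x + (h * xi k 0) *: basis_vec R k) - f (h *: v + x)
    = h * xi k 0 * df k (h *: v + x + s *: basis_vec R k).
  by apply: line_MVT => s /segP/ballP[].
have -> : h *: (xi k 0 *: basis_vec R k + v) + x
    = h *: v + x + (h * xi k 0) *: basis_vec R k.
  by rewrite scalerDr scalerA -addrA addrC.
set y := h *: v + x + s *: basis_vec R k in sE.
have dy : `|df k y - df k x| <= e' by rewrite distrC; have [] := ballP _ (segP s sh).
have -> : f (h *: v + x + (h * xi k 0) *: basis_vec R k) - f x
    - h * (xi k 0 * df k x + d)
  = h * xi k 0 * (df k y - df k x) + (f (h *: v + x) - f x - h * d).
  by rewrite mulrBr -sE; ring.
rewrite (le_trans (ler_normD _ _))//.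
have xe : `|xi k 0| * e' <= e / 2.
  rewrite /e' invfM [e * _]mulrA mulrA ler_pdivrMr// mulrC ler_wpM2l ?lerDr//.
  by rewrite divr_ge0 ?ltW.
rewrite [e in leRHS]splitr mulrDl lerD// -mulrA !normrM mulrC ler_wpM2r//.
by rewrite (le_trans _ xe)// ler_wpM2l.
Unshelve. all: by end_near. Qed.

(** A maximum over a space-time cylinder may sit at the final time, where only earlier times can be
    compared. *)
Lemma left_max_derive_ge0 (R : realType) (f : R -> R) (a c d : R) :
  a < c -> (forall t, a < t -> t <= c -> f t <= f c) -> is_derive c 1 f d ->
  0 <= d.
Proof.
move=> ac fmax /is_derive_near H; rewrite leNgt; apply/negP => d0.
have /H : 0 < - d / 2 by rewrite divr_gt0// oppr_gt0.
move=> /nbhs_ballP[r /= r0 ballP].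
pose h := Num.min (r / 2) ((c - a) / 2).
have h0 : 0 < h by rewrite lt_min !divr_gt0// subr_gt0.
have hr : h < r by rewrite (@le_lt_trans _ _ (r / 2)) ?ge_min ?lexx//; lra.
have hca : h < c - a.
  rewrite (@le_lt_trans _ _ ((c - a) / 2)) ?ge_min ?lexx ?orbT//; lra.
have := ballP (- h).
rewrite -ball_normE /ball_ /= sub0r opprK gtr0_norm// => /(_ hr).
rewrite normrN (gtr0_norm h0) [_ *: 1]mulr1 ler_norml => /andP[+ _].
have : f (- h + c) <= f c by apply: fmax; lra.
nra.
Qed.

(** If [d > 0], then [df] vanishes at 0 and is positive just to the right of it, so the mean value
    theorem produces a value above [f 0]. *)
Lemma max_derive2_le0 (R : realType) (f df : R -> R) (d r : R) :
  0 < r -> (forall s : R, `|s| < r -> is_derive s 1 f (df s)) ->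
  (forall s, `|s| < r -> f s <= f 0) -> is_derive (0 : R) 1 df d ->
  df 0 = 0 /\ d <= 0.
Proof.
move=> r0 fP fmax dfP.
have r_itv s : s \in `](- r), r[%R -> `|s| < r by rewrite in_itv/= ltr_norml.
have df0 : df 0 = 0.
  have d0 : is_derive (0 : R) 1 f 0.
    apply: (@derive1_at_max _ f (- r) r); first by lra.
    - by move=> t /r_itv/fP[].
    - by rewrite in_itv/= oppr_lt0 r0.
    - by move=> t /r_itv/fmax.
  have := fP 0; rewrite normr0 => /(_ r0) d1.
  by rewrite -(@derive_val _ _ _ _ _ _ _ d1) (@derive_val _ _ _ _ _ _ _ d0).
split=> //; rewrite leNgt; apply/negP => d0.
have /is_derive_near/(_ (d / 2)) := dfP.
rewrite divr_gt0// => /(_ isT) /nbhs_ballP[q /= q0 ballP].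
pose h := Num.min (r / 2) (q / 2).
have h0 : 0 < h by rewrite lt_min !divr_gt0.
have hr : h < r by rewrite (@le_lt_trans _ _ (r / 2)) ?ge_min ?lexx//; lra.
have hq : h < q by rewrite (@le_lt_trans _ _ (q / 2)) ?ge_min ?lexx ?orbT//; lra.
have [||c] := @MVT R f df 0 h h0.
- move=> s; rewrite in_itv/= => /andP[s0 sh]; apply: fP.
  by rewrite gtr0_norm// (lt_trans sh).
- apply: derivable_within_continuous => s; rewrite in_itv/= => /andP[s0 sh].
  by have [] := fP s _; rewrite ?ger0_norm// (le_lt_trans sh).
- rewrite in_itv/= subr0 => /andP[c0 ch] E.
  have := ballP c.
  rewrite -ball_normE /ball_ /= sub0r normrN gtr0_norm// => /(_ (lt_trans ch hq)).
  rewrite addr0 [_ *: 1]mulr1 df0 subr0 ler_norml => /andP[+ _].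
  have fh : f h <= f 0 by apply: fmax; rewrite gtr0_norm.
  move=> dc; have dfc : 0 < df c by have := mulr_gt0 c0 d0; lra.
  by have := mulr_gt0 dfc h0; rewrite -E; lra.
Qed.

(** * Maximum principle *)

Lemma open_cyl (R : realType) (n : nat) (U : set 'cV[R]_n) :
  open U -> open (cyl U).
Proof.
move=> U_open; rewrite openE => -[x t] [/= Ux t0].
exists (U, [set t : R | 0 < t]) => //=; split.
- exact: open_nbhs_nbhs.
- by apply: open_nbhs_nbhs; split=> //; exact: open_gt.
Qed.

Lemma cont_on_cyl_slice (R : realType) (n : nat) (U : set 'cV[R]_n)
    (w : 'cV[R]_n -> R -> R) (x : 'cV[R]_n) (t : R) :
  open U -> cont_on (cyl U) w -> cyl U (x, t) -> {for x, continuous (w ^~ t)}.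
Proof.
move=> U_open; rewrite /cont_on (continuous_open_subspace _ (open_cyl U_open)).
move=> wC xt; have := wC (x, t); rewrite inE => /(_ xt) wxt.
apply: (@continuous_comp _ _ _ (fun y => (y, t)) (fun p => w p.1 p.2)) => //.
move=> A [[P1 P2] /= [xP1 tP2] PA]; apply: (filterS _ xP1) => y yP1.
by apply: (PA (y, t)); split => //=; exact: nbhs_singleton tP2.
Qed.

Lemma is_derive_dx (R : realType) (n : nat) (U : set 'cV[R]_n)
    (w : 'cV[R]_n -> R -> R) (x xi : 'cV[R]_n) (t : R) :
  open U ->
  (forall i, (forall x t, cyl U (x, t) -> derivable (w ^~ t) x (basis_vec R i))
    /\ cont_on (cyl U) (dx i w)) ->
  cyl U (x, t) -> is_derive x xi (w ^~ t) (\sum_i xi i 0 * dx i w x t).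
Proof.
move=> U_open wP xt; have [/= Ux t0] := xt.
apply: (is_derive_partials (df := fun i y => dx i w y t)) => [|i].
  have : nbhs x U by exact: open_nbhs_nbhs.
  apply: filterS => y Uy i; apply: derivableP.
  by have [H _] := wP i; exact: H.
by have [_ H] := wP i; exact: cont_on_cyl_slice H xt.
Qed.

Lemma qformD (R : realType) (n : nat) (A B : 'M[R]_n) (v : 'cV[R]_n) :
  qform (A + B) v = qform A v + qform B v.
Proof. by rewrite /qform mulmxDr mulmxDl mxE. Qed.

Lemma qformZ (R : realType) (n : nat) (a : R) (A : 'M[R]_n) (v : 'cV[R]_n) :
  qform (a *: A) v = a * qform A v.
Proof. by rewrite /qform -scalemxAr -scalemxAl mxE. Qed.

Lemma qformB (R : realType) (n : nat) (A B : 'M[R]_n) (v : 'cV[R]_n) :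
  qform (A - B) v = qform A v - qform B v.
Proof. by rewrite -scaleN1r qformD qformZ mulN1r. Qed.

Lemma qform_rank1 (R : realType) (n : nat) (w v : 'cV[R]_n) :
  qform (w *m w^T) v = dotp v w ^+ 2.
Proof.
rewrite /qform -!mulmxA mulmxA mxE big_ord1 expr2; congr (_ * _).
  by rewrite mxE; apply: eq_bigr => i _; rewrite mxE.
by rewrite mxE; apply: eq_bigr => i _; rewrite mxE mulrC.
Qed.

(** First-order conditions in time and space and the second-order condition in space, each read off
    a function of one variable: the past at [x0], and the lines through [x0] at time [t0]. As [S]
    depends on the coordinate [i] alone, the gradient condition points along the [i]-th basis
    vector. *)
Lemma max_point (R : realType) (n : nat) (U : set 'cV[R]_n)
    (u : 'cV[R]_n -> R -> R) (Phi Phi1 Phi2 : R -> R) (i : 'I_n)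
    (S S1 S2 Q H : R -> R) (q h a t0 : R) (x0 : 'cV[R]_n) :
  open U -> C21 U u -> (forall x t, cyl U (x, t) -> 0 < u x t) ->
  (forall s : R, 0 < s -> is_derive s 1 Phi (Phi1 s)) ->
  (forall s : R, 0 < s -> is_derive s 1 Phi1 (Phi2 s)) ->
  (forall s : R, is_derive s 1 S (S1 s)) ->
  (forall s : R, is_derive s 1 S1 (S2 s)) ->
  is_derive t0 1 Q q -> is_derive t0 1 H h ->
  0 <= a -> a < t0 -> U x0 ->
  (forall x t, U x -> a < t -> t <= t0 ->
     Phi (u x t) - (Q t * S (x i 0) + H t)
     <= Phi (u x0 t0) - (Q t0 * S (x0 i 0) + H t0)) ->
  [/\ q * S (x0 i 0) + h <= Phi1 (u x0 t0) * dt u x0 t0,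
      Phi1 (u x0 t0) *: grad u x0 t0 = (Q t0 * S1 (x0 i 0)) *: basis_vec R i
    & forall v, qform (Phi1 (u x0 t0) *: hessian u x0 t0
         + Phi2 (u x0 t0) *: (grad u x0 t0 *m (grad u x0 t0)^T)
         - (Q t0 * S2 (x0 i 0)) *: delta_mx i i) v <= 0].
Proof.
move=> U_open [u_cont [u_dt _] u_dx u_ddx] u_pos PhiP Phi1P SP S1P QP HP a0 at0
  Ux0 umax.
have t00 : 0 < t0 by exact: le_lt_trans at0.
have xt0 : cyl U (x0, t0) by [].
have u0 := u_pos _ _ xt0.
(* [D v s] and [E v] are the first derivative at [x0 + s v] and the second derivative at [x0] of [u]
   in the direction [v]. *)
pose D (v : 'cV[R]_n) (s : R) := \sum_j v j 0 * dx j u (x0 + s *: v) t0.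
pose E (v : 'cV[R]_n) := \sum_j v j 0 * \sum_k v k 0 * dx k (dx j u) x0 t0.
have spaceP v :
    Phi1 (u x0 t0) * D v 0 - Q t0 * (S1 (x0 i 0) * v i 0) = 0 /\
    Phi2 (u x0 t0) * D v 0 * D v 0 + Phi1 (u x0 t0) * E v
    - Q t0 * (S2 (x0 i 0) * v i 0 * v i 0) <= 0.
  have /nbhs_ballP[r /= r0 rU] : nbhs x0 U by exact: open_nbhs_nbhs.
  have v1 : 0 < 1 + `|v| by rewrite ltr_pwDl.
  have segU (s : R) : `|s| < r / (1 + `|v|) -> U (x0 + s *: v).
    move=> sr; apply: rU; rewrite -ball_normE /ball_ /= opprD addNKr normrN.
    rewrite normrZ; move: sr; rewrite ltr_pdivlMr//; apply: le_lt_trans.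
    by rewrite ler_wpM2l// lerDr.
  pose w s := u (x0 + s *: v) t0.
  have wP (s : R) : `|s| < r / (1 + `|v|) -> is_derive s 1 w (D v s).
    move=> /segU Us; apply: (@is_derive_line _ _ (u ^~ t0)).
    exact: (is_derive_dx _ U_open u_dx).
  have DP : is_derive (0 : R) 1 (D v) (E v).
    have dP j : is_derive (0 : R) 1 (fun s => dx j u (x0 + s *: v) t0)
        (\sum_k v k 0 * dx k (dx j u) x0 t0).
      apply: (@is_derive_line _ _ (dx j u ^~ t0)).
      rewrite scale0r addr0.
      exact: (is_derive_dx _ U_open (fun k => u_ddx k j)).
    have := @is_derive_sum _ _ _ n
      (fun j (s : R) => v j 0 * dx j u (x0 + s *: v) t0) (0 : R) 1
      (fun j => v j 0 * \sum_k v k 0 * dx k (dx j u) x0 t0)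
      (fun j => is_deriveZ (v j 0) (dP j)).
    rewrite fct_sumE; exact.
  have lineP (T T1 : R -> R) (s : R) : is_derive (x0 i 0 + s * v i 0) 1 T
      (T1 (x0 i 0 + s * v i 0)) ->
      is_derive s 1 (fun s => T (x0 i 0 + s * v i 0))
        (T1 (x0 i 0 + s * v i 0) * v i 0).
    move=> TP.
    have lP : is_derive s 1 (fun s : R => x0 i 0 + s * v i 0) (v i 0).
      by apply: is_derive_affine => h'; ring.
    exact: (@is_derive1_comp _ T (fun s => x0 i 0 + s * v i 0) _ _ _ TP lP).
  pose phi s := Phi (w s) - (Q t0 * S (x0 i 0 + s * v i 0) + H t0).
  pose dphi s := Phi1 (w s) * D v s - Q t0 * (S1 (x0 i 0 + s * v i 0) * v i 0).
  have phiP (s : R) : `|s| < r / (1 + `|v|) -> is_derive s 1 phi (dphi s).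
    move=> sr; have Us := segU s sr.
    have ws : 0 < w s by apply: u_pos; split.
    have d1 := is_derive1_comp (PhiP _ ws) (wP _ sr).
    have d2 := lineP S S1 s (SP _).
    have d3 := is_deriveB d1 (is_deriveD (is_deriveZ (Q t0) d2)
      (is_derive_cst (H t0) s 1)).
    by apply: (is_derive_eq d3); rewrite addr0.
  have r'0 : 0 < r / (1 + `|v|) by exact: divr_gt0.
  have w0 : w 0 = u x0 t0 by rewrite /w scale0r addr0.
  have phimax (s : R) : `|s| < r / (1 + `|v|) -> phi s <= phi 0.
    move=> sr; rewrite /phi w0 mul0r addr0.
    have := umax (x0 + s *: v) t0 (segU s sr) at0 (lexx _).
    by rewrite !mxE.
  have dphiP : is_derive (0 : R) 1 dphi (Phi2 (u x0 t0) * D v 0 * D v 0 +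
      Phi1 (u x0 t0) * E v - Q t0 * (S2 (x0 i 0) * v i 0 * v i 0)).
    have d1 : is_derive (0 : R) 1 (Phi1 \o w) (Phi2 (w 0) * D v 0).
      apply: (@is_derive1_comp _ Phi1 w); last by apply: wP; rewrite normr0.
      by rewrite w0; exact: Phi1P.
    have d2 := lineP S1 S2 0 (S1P _).
    have d3 := is_deriveB (is_deriveM d1 DP) (is_deriveZ (Q t0)
      (is_deriveZ (v i 0) d2)).
    have -> : dphi = (Phi1 \o w) * D v -
       Q t0 \*: (v i 0 \*: (fun s => S1 (x0 i 0 + s * v i 0))).
      by apply/funext => s; rewrite /dphi /= !fctE [_ * v i 0]mulrC.
    by apply: (is_derive_eq d3); rewrite /= w0 !mul0r !addr0 /GRing.scale /=; ring.
  have [+ ?] := max_derive2_le0 r'0 phiP phimax dphiP.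
  by rewrite /dphi w0 mul0r addr0.
have D0 v : D v 0 = \sum_j v j 0 * grad u x0 t0 j 0.
  by rewrite /D; apply: eq_bigr => j _; rewrite scale0r addr0 mxE.
split.
- have wP : is_derive t0 1 (u x0) (dt u x0 t0).
    by rewrite /dt derive1E; apply: derivableP; exact: u_dt.
  have d1 := is_derive1_comp (PhiP _ u0) wP.
  have d3 := is_deriveB d1 (is_deriveD (is_deriveZ (S (x0 i 0)) QP) HP).
  rewrite -subr_ge0.
  apply: (@left_max_derive_ge0 _ (fun t => Phi (u x0 t) - (Q t * S (x0 i 0) + H t))
    a t0) => //.
  + by move=> t at_ tt0; exact: umax.
  + have -> : (fun t => Phi (u x0 t) - (Q t * S (x0 i 0) + H t))
        = (Phi \o u x0) - (S (x0 i 0) \*: Q + H).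
      by apply/funext => t; rewrite !fctE /= [Q t * _]mulrC.
    by apply: (is_derive_eq d3); rewrite /GRing.scale /= [_ * q]mulrC.
- apply/colP => k; have [+ _] := spaceP (basis_vec R k).
  rewrite D0 (bigD1 k)//= !mxE !eqxx mul1r big1 ?addr0; last first.
    by move=> j jk; rewrite !mxE (negbTE jk) mul0r.
  by move/eqP; rewrite subr_eq0 => /eqP ->; rewrite mulrA eq_sym.
- move=> v; have [_] := spaceP v; rewrite D0; apply: le_trans.
  have hessE : qform (hessian u x0 t0) v = E v.
    rewrite -qform_dotp /dotp /E.
    under eq_bigr => j _ do rewrite mxE mulr_sumr.
    under [in RHS]eq_bigr => j _ do rewrite mulr_sumr.
    rewrite exchange_big /=; apply: eq_bigr => j _; apply: eq_bigr => k _.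
    by rewrite mxE; ring.
  rewrite qformB qformD !qformZ hessE qform_rank1.
  have -> : delta_mx i i = basis_vec R i *m (basis_vec R i)^T.
    by rewrite trmx_delta mul_delta_mx.
  rewrite qform_rank1.
  have -> : dotp v (basis_vec R i) = v i 0.
    rewrite /dotp (bigD1 i)//= !mxE !eqxx mulr1 big1 ?addr0// => j ji.
    by rewrite !mxE (negbTE ji) mulr0.
  by rewrite le_eqVlt; apply/orP; left; apply/eqP; rewrite /dotp; ring.
Qed.

(** * Compactness of closures of bounded sets, and Euclidean lengths *)

Lemma trmx_continuous (R : realType) (m n : nat) :
  continuous (fun A : 'M[R]_(m, n) => A^T).
Proof.
move=> A B /nbhs_ballP[e /= e0 eB]; apply/nbhs_ballP; exists e => //= C [_ AC].
by apply: eB; split=> // i j; rewrite !mxE.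
Qed.

(** Products of segments are compact in row vectors; transposition carries this over to columns. *)
Lemma compact_box (R : realType) (n : nat) (M : R) :
  compact [set x : 'cV[R]_n | forall i, `|x i 0| <= M].
Proof.
have -> : [set x : 'cV[R]_n | forall i, `|x i 0| <= M]
    = (fun w : 'rV[R]_n => w^T) @` [set w : 'rV[R]_n | forall i, `[- M, M]%classic (w ord0 i)].
  apply/seteqP; split=> [x xM|_ [w wM <-] i].
    exists x^T; last by rewrite trmxK.
    by move=> i; rewrite mxE /= in_itv/= -ler_norml; exact: xM.
  by have := wM i; rewrite /= in_itv/= -ler_norml mxE.
apply: continuous_compact.
  exact: (continuous_subspaceT (@trmx_continuous R 1 n)).
by apply: (@rV_compact _ _ (fun=> `[- M, M]%classic)) => i; exact: segment_compact.
Qed.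

Lemma closure_box (R : realType) (n : nat) (U : set 'cV[R]_n) :
  bounded_set U ->
  exists M : R, closure U `<=` [set x | forall i, `|x i 0| <= M].
Proof.
move=> [M [_ UM]]; exists (M + 1).
pose C := [set x : 'cV[R]_n | forall i, `|x i 0| <= M + 1].
have C_closed : closed C.
  by apply: compact_closed; [exact: norm_hausdorff|exact: compact_box].
suff UC : U `<=` C.
  by apply: subset_trans (closure_subset UC) _; rewrite -((closure_id C).1 C_closed).
move=> x Ux i.
have /UM/(_ x Ux) : M < M + 1 by rewrite ltrDl.
apply: le_trans; rewrite -[leRHS]/(mx_norm x) mx_normrE.
exact: (le_bigmax _ (fun ij => `|x ij.1 ij.2|) (i, 0)).
Qed.

Lemma compact_closure (R : realType) (n : nat) (U : set 'cV[R]_n) :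
  bounded_set U -> compact (closure U).
Proof.
move=> /closure_box[M UM].
exact: subclosed_compact (@closed_closure _ _) (@compact_box _ _ M) UM.
Qed.

Lemma enorm_ge_coord (R : realType) (n : nat) (v : 'cV[R]_n) (i : 'I_n) :
  `|v i 0| <= enorm v.
Proof.
rewrite -sqrtr_sqr ler_wsqrtr// /dotp (bigD1 i)//= expr2 lerDl.
by apply: sumr_ge0 => j _; rewrite -expr2 sqr_ge0.
Qed.

Lemma coord_le_diam (R : realType) (n : nat) (U : set 'cV[R]_n) (x y : 'cV[R]_n)
    (i : 'I_n) :
  bounded_set U -> closure U x -> closure U y -> x i 0 - y i 0 <= diam U.
Proof.
move=> /closure_box[M UM] Ux Uy.
apply: (@le_trans _ _ (enorm (x - y))).
  apply: le_trans (enorm_ge_coord _ i); rewrite !mxE; exact: ler_norm.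
apply: ub_le_sup; last by exists (x, y).
(* [sup] is meaningful only for a set bounded above; in the box two points differ by at most [M + M]
   in each coordinate. *)
exists (Num.sqrt (\sum_(i < n) (M + M) ^+ 2)) => _ [[a b] [/= Ua Ub] <-].
rewrite ler_wsqrtr// /dotp; apply: ler_sum => j _; rewrite -expr2 !mxE.
have := UM _ Ua j; have := UM _ Ub j; rewrite !ler_norml => /andP[? ?] /andP[? ?].
nra.
Qed.

Lemma dotpC (R : realType) (n : nat) (v w : 'cV[R]_n) : dotp v w = dotp w v.
Proof. by apply: eq_bigr => i _; rewrite mulrC. Qed.

Lemma dotpZr (R : realType) (n : nat) (a : R) (v w : 'cV[R]_n) :
  dotp v (a *: w) = a * dotp v w.
Proof. by rewrite /dotp mulr_sumr; apply: eq_bigr => i _; rewrite mxE; ring. Qed.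

Lemma dotp_basis (R : realType) (n : nat) (v : 'cV[R]_n) (i : 'I_n) :
  dotp v (basis_vec R i) = v i 0.
Proof.
rewrite /dotp (bigD1 i)//= !mxE !eqxx mulr1 big1 ?addr0// => j ji.
by rewrite !mxE (negbTE ji) mulr0.
Qed.

Lemma enorm_sqr (R : realType) (n : nat) (v : 'cV[R]_n) : enorm v ^+ 2 = dotp v v.
Proof.
by rewrite sqr_sqrtr// sumr_ge0// => i _; rewrite -expr2 sqr_ge0.
Qed.

Lemma enorm_gt0 (R : realType) (n : nat) (v : 'cV[R]_n) : v != 0 -> 0 < enorm v.
Proof.
move=> v0; have [i vi0] : exists i, v i 0 != 0.
  apply/existsP; apply: contra_neqT v0; rewrite negb_exists => /forallP v0.
  by apply/colP => i; rewrite mxE; apply/eqP; have := v0 i; rewrite negbK.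
by apply: lt_le_trans (enorm_ge_coord v i); rewrite normr_gt0.
Qed.

Lemma mxdotpDr (R : realType) (n : nat) (A B C : 'M[R]_n) :
  mxdotp A (B + C) = mxdotp A B + mxdotp A C.
Proof. by rewrite /mxdotp mulmxDr mxtraceD. Qed.

Lemma mxdotpZr (R : realType) (n : nat) (a : R) (A B : 'M[R]_n) :
  mxdotp A (a *: B) = a * mxdotp A B.
Proof. by rewrite /mxdotp -scalemxAr mxtraceZ. Qed.

Lemma mxdotp_rank1 (R : realType) (n : nat) (A : 'M[R]_n) (w : 'cV[R]_n) :
  A^T = A -> mxdotp A (w *m w^T) = dotp w (A *m w).
Proof.
move=> Asym; rewrite /mxdotp Asym qform_dotp /qform mulmxA mxtrace_mulC.
by rewrite trace_mx11 mulmxA.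
Qed.

(** * Comparison with a barrier *)

(** Positivity is demanded on the closed cylinder: [Phi] will be a power, smooth on positive numbers
    only, and [Phi (u x t)] has to be continuous up to the boundary for a maximum to exist. *)
Record log_solution (R : realType) (n : nat) (U : set 'cV[R]_n)
    (A : 'cV[R]_n -> R -> 'M[R]_n) (K : 'cV[R]_n -> R -> 'M[R]_n)
    (B : 'cV[R]_n -> R -> R -> 'cV[R]_n) (c0 c1 c2 : R)
    (u f : 'cV[R]_n -> R -> R) : Prop := LogSolution {
  sol_domain_neq0 : U !=set0;
  sol_domain_open : open U;
  sol_domain_bounded : bounded_set U;
  sol_c0_gt0 : 0 < c0;
  sol_A_sym : forall x t, cyl U (x, t) -> (A x t)^T = A x t;
  sol_A_ell : forall x t (xi : 'cV[R]_n), cyl U (x, t) ->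
    c0 * enorm xi ^+ 2 <= dotp xi (A x t *m xi);
  sol_K_bnd : forall x t (xi : 'cV[R]_n), cyl U (x, t) ->
    - c1 * enorm xi ^+ 2 <= dotp xi (K x t *m xi) <= c2 * enorm xi ^+ 2;
  sol_cont : cont_on (ccyl U) u;
  sol_C21 : C21 U u;
  sol_pos : forall x t, ccyl U (x, t) -> 0 < u x t;
  sol_eq : forall x t, cyl U (x, t) -> Lop (@ln R) A B K u x t = f x t
}.

(** If the bound fails, [Phi (u) - (Q S + H)] has a positive maximum over the compact cylinder,
    attained inside [U] and after time [a]. There the gradient of [Phi (u)] is [Q S1] times a basis
    vector, so the drift costs at most [Q z S1]; the Hessian condition paired with [A] yields
    [c0 Q S2]; [bracket] gives the sign of the terms quadratic in the gradient; and the sum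
    contradicts [strict]. In the alternative [Q = 0] the gradient of [u] vanishes at the maximum,
    which removes the drift and the quadratic terms together. *)
Lemma comparison (R : realType) (n : nat) (U : set 'cV[R]_n)
    (A : 'cV[R]_n -> R -> 'M[R]_n) (K : 'cV[R]_n -> R -> 'M[R]_n)
    (B : 'cV[R]_n -> R -> R -> 'cV[R]_n) (c0 c1 c2 : R)
    (u f : 'cV[R]_n -> R -> R) (F : R -> R) (z : R)
    (Phi Phi1 Phi2 : R -> R) (i : 'I_n) (S S1 S2 Q H q h : R -> R) (a b : R) :
  log_solution U A K B c0 c1 c2 u f ->
  0 <= a -> a <= b ->
  (forall x t, U x -> a < t -> t <= b -> `|f x t| <= F t) ->
  (forall x t, U x -> a < t -> t <= b -> Q t = 0 \/ enorm (B x t (u x t)) <= z) ->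
  (forall s : R, 0 < s -> is_derive s 1 Phi (Phi1 s)) ->
  (forall s : R, 0 < s -> is_derive s 1 Phi1 (Phi2 s)) ->
  (forall s : R, is_derive s 1 S (S1 s)) ->
  (forall s : R, is_derive s 1 S1 (S2 s)) ->
  (forall s, 0 <= S1 s) -> (forall s, S2 s <= 0) ->
  (forall t : R, a < t -> t <= b -> is_derive t 1 Q (q t)) ->
  (forall t : R, a < t -> t <= b -> is_derive t 1 H (h t)) ->
  {within `[a, b], continuous Q} -> {within `[a, b], continuous H} ->
  (forall t, a < t -> t <= b -> 0 <= Q t) ->
  (forall s al ka e, 0 < s -> 0 <= e -> c0 * e <= al ->
     - c1 * e <= ka <= c2 * e -> 0 <= Phi2 s * al + Phi1 s / s * ka)
  \/ (forall t, Q t = 0) /\ (forall s, 0 < s -> Phi1 s != 0) ->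
  (forall x t, U x -> a < t -> t <= b ->
     `|Phi1 (u x t)| * F t + Q t * (c0 * S2 (x i 0) + z * S1 (x i 0))
     < q t * S (x i 0) + h t) ->
  (forall x, closure U x -> Phi (u x a) <= Q a * S (x i 0) + H a) ->
  (forall x t, boundary U x -> a <= t -> t <= b ->
     Phi (u x t) <= Q t * S (x i 0) + H t) ->
  forall x t, closure U x -> a <= t -> t <= b ->
     Phi (u x t) <= Q t * S (x i 0) + H t.
Proof.
move=> [[x' Ux'] U_open U_bnd c0_gt0 A_sym A_ell K_bnd u_cont u_C21 u_pos u_eq] a0 ab
  f_bnd B_bnd PhiP Phi1P SP S1P S1_ge0 S2_le0 QP HP Q_cont H_cont Q_ge0 bracket
  strict init bdry.
pose D (p : 'cV[R]_n * R) := Phi (u p.1 p.2) - (Q p.2 * S (p.1 i 0) + H p.2).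
pose C := closure U `*` `[a, b].
have C_cpt : compact C.
  by apply: compact_setX; [exact: compact_closure|exact: segment_compact].
have C0 : C !=set0.
  exists (x', a); split => /=; first exact: subset_closure.
  by rewrite in_itv/= lexx.
have cont2 (g : R -> R) : {within `[a, b], continuous g} ->
    {within C, continuous (fun p : 'cV[R]_n * R => g p.2)}.
  move=> /subspace_continuousP gC; apply/subspace_continuousP => -[y s] [/= Uy sab].
  apply: (@cvg_comp _ _ _ snd g _ _ _ _ (gC s sab)) => P sP.
  exists (setT, [set r | `[a, b]%classic r -> P r]); first by split=> //; exact: filterT.
  by move=> [y' s'] [/= _ Ps'] [/= _ s'ab]; exact: Ps'.
have derC (g g1 : R -> R) (r : R) : is_derive r 1 g (g1 r) -> {for r, continuous g}.
  by move=> [+ _] => /derivable1_diffP; exact: differentiable_continuous.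
have D_cont : {within C, continuous D}.
  have uC : {within C, continuous (fun p : 'cV[R]_n * R => u p.1 p.2)}.
    apply: continuous_subspaceW u_cont => -[y s] [/= Uy]; rewrite in_itv/=.
    by move=> /andP[as_ _]; split=> //=; exact: le_trans as_.
  apply/subspace_continuousP => -[y s] Cys; have [/= Uy sab] := Cys.
  apply: cvgB.
    move/subspace_continuousP: uC => /(_ _ Cys) uC.
    apply: (@cvg_comp _ _ _ (fun p : 'cV[R]_n * R => u p.1 p.2) Phi _ _ _ uC).
    apply: (derC Phi Phi1); apply: PhiP.
    apply: u_pos; move: sab; rewrite in_itv/= => /andP[as_ _].
    by split => //=; exact: le_trans as_.
  apply: cvgD; last by move/subspace_continuousP: (cont2 _ H_cont); exact.
  apply: cvgM; first by move/subspace_continuousP: (cont2 _ Q_cont); exact.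
  apply: (@cvg_comp _ _ _ (fun p : 'cV[R]_n * R => p.1 i 0) S _ (nbhs (y i 0))); last first.
    by apply: (derC _ S1); exact: SP.
  apply: cvg_within_filter.
  apply: (@cvg_comp _ _ _ fst (fun v : 'cV[R]_n => v i 0) _ (nbhs y)).
    exact: cvg_fst.
  exact: coord_continuous.
have [[x0 t0]] := compact_EVT_max C0 C_cpt D_cont.
rewrite inE => -[/= Ux0]; rewrite in_itv/= => /andP[at0 t0b] Dmax x t Ux at_ tb.
rewrite -subr_le0 leNgt; apply/negP => Dpos.
have {}Dmax y s : closure U y -> a <= s -> s <= b -> D (y, s) <= D (x0, t0).
  by move=> Uy as_ sb; apply: Dmax; rewrite inE; split; rewrite //= in_itv/= as_.
have D0 : 0 < D (x0, t0) by apply: lt_le_trans (Dmax x t _ _ _).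
(* A positive maximum is excluded at the initial time by [init], and on the lateral boundary by
   [bdry]. *)
have {}at0 : a < t0.
  rewrite lt_neqAle at0 andbT; apply/eqP => at0E; move: D0.
  by rewrite ltNge subr_le0 /= -at0E init.
have {}Ux0 : U x0.
  apply: contrapT => nUx0; move: D0; rewrite ltNge subr_le0 /= bdry ?(ltW at0)//.
  by split=> //; rewrite ((interior_id U).1 U_open).
have xt0 : cyl U (x0, t0) by split=> //=; exact: le_lt_trans at0.
have u_pos' y s : cyl U (y, s) -> 0 < u y s.
  move=> [/= Uy s0]; apply: u_pos; split=> /=; first exact: subset_closure.
  exact: ltW.
have [pt pg ph] := max_point U_open u_C21 u_pos' PhiP Phi1P SP S1P
  (QP _ at0 t0b) (HP _ at0 t0b) a0 at0 Ux0
  (fun y s Uy as_ st0 => Dmax y s (subset_closure Uy) (ltW as_) (le_trans st0 t0b)).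
have u0 : 0 < u x0 t0 by exact: u_pos'.
have Apos v : v != 0 -> 0 < qform (A x0 t0) v.
  move=> v0; rewrite -qform_dotp; apply: lt_le_trans (A_ell _ _ _ xt0).
  by rewrite mulr_gt0// exprn_gt0// enorm_gt0.
have := mxdotp_le0 (A_sym _ _ xt0) Apos ph.
rewrite -scaleNr !mxdotpDr !mxdotpZr (mxdotp_rank1 _ (A_sym _ _ xt0)).
have -> : delta_mx i i = basis_vec R i *m (basis_vec R i)^T.
  by rewrite trmx_delta mul_delta_mx.
rewrite (mxdotp_rank1 _ (A_sym _ _ xt0)).
(* Ellipticity in a coordinate direction: the diagonal entry is at least [c0]. With [S2 <= 0] it may
   be replaced by [c0]. *)
have := A_ell x0 t0 (basis_vec R i) xt0.
rewrite enorm_sqr dotp_basis !mxE !eqxx mulr1.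
set Aii := dotp (basis_vec R i) _ => Aii_ge.
set g := grad u x0 t0 in pg *; set AH := mxdotp _ _.
set p1 := Phi1 _ in pt pg *; set p2 := Phi2 _ => Hle.
have := u_eq _ _ xt0; rewrite /Lop derive1E.
rewrite (@derive_val _ _ _ _ _ _ _ (is_derive1_ln u0)) -/AH -/g => E.
have p1B : p1 * dotp (B x0 t0 (u x0 t0)) g
    = Q t0 * S1 (x0 i 0) * B x0 t0 (u x0 t0) i 0.
  by rewrite -dotpZr pg dotpZr dotp_basis.
have br : 0 <= p2 * dotp g (A x0 t0 *m g) + p1 / u x0 t0 * dotp g (K x0 t0 *m g).
  case: bracket => [br|[Q0 p10]].
    by apply: (br _ _ _ (enorm g ^+ 2)) => //; [rewrite sqr_ge0|exact: A_ell|exact: K_bnd].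
  have -> : g = 0.
    move: pg; rewrite Q0 mul0r scale0r => /eqP.
    by rewrite scaler_eq0 (negbTE (p10 _ u0)) => /eqP.
  by rewrite !mulmx0 /dotp !big1 ?mulr0 ?addr0// => k _; rewrite mxE mul0r.
have Qt0 := Q_ge0 _ at0 t0b.
have := strict x0 t0 Ux0 at0 t0b; rewrite ltNge => /negP; apply.
apply: (le_trans pt).
have -> : p1 * dt u x0 t0 = p1 * f x0 t0 + p1 * AH
    - p1 * dotp (B x0 t0 (u x0 t0)) g
    - p1 / u x0 t0 * dotp g (K x0 t0 *m g).
  by rewrite -E (dotpC (K x0 t0 *m g)); field; rewrite gt_eqF.
have pf : p1 * f x0 t0 <= `|p1| * F t0.
  apply: (le_trans (ler_norm _)); rewrite normrM ler_wpM2l//.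
  exact: f_bnd.
rewrite p1B.
have h1 : 0 <= Q t0 * S1 (x0 i 0) * (z + B x0 t0 (u x0 t0) i 0).
  have [->|Bz] := B_bnd x0 t0 Ux0 at0 t0b; first by rewrite !mul0r.
  have := enorm_ge_coord (B x0 t0 (u x0 t0)) i.
  by rewrite ler_norml => /andP[? ?]; rewrite !mulr_ge0//; lra.
have h2 : Q t0 * S2 (x0 i 0) * (Aii - c0) <= 0.
  by rewrite mulr_le0_ge0 ?mulr_ge0_le0 ?subr_ge0.
rewrite -/p1; move: h1 h2 pf br Hle; rewrite -/p1 -/p2.
set a1 := dotp g _; set a2 := dotp g _; lra.
Qed.

(** * Integrals over growing intervals *)

Lemma is_derive_primitive (R : realType) (f : R -> R) (a b t : R) :
  a < t -> t < b -> {within `[a, b], continuous f} ->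
  is_derive t 1
    (fun s => \int[@lebesgue_measure R]_(x in `[a, s]) f x)%R (f t).
Proof.
move=> at_ tb fC.
have fI : (@lebesgue_measure R).-integrable `[a, b] (EFin \o f).
  by apply: continuous_compact_integrable => //; exact: segment_compact.
have ft : {for t, continuous f}.
  by apply: (within_continuous_continuous (lt_trans at_ tb) fC); rewrite in_itv/= at_.
have [d1 d2] := continuous_FTC1_closed tb fI at_ ft.
by apply: (DeriveDef d1); rewrite -derive1E.
Qed.

Lemma continuous_primitive (R : realType) (f : R -> R) (a b : R) :
  a <= b -> {within `[a, b], continuous f} ->
  {within `[a, b], continuous
    (fun s => \int[@lebesgue_measure R]_(x in `[a, s]) f x)%R}.
Proof.
move=> ab fC; apply: parameterized_integral_continuous => //.
by apply: continuous_compact_integrable => //; exact: segment_compact.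
Qed.

(** The integral over a ray is the supremum of those over segments, so an infinite one exceeds [M]
    on some segment, and nonnegativity preserves this on longer ones. Extending [f] by 0 lets all
    segments start at 0. *)
Lemma integral_unbounded (R : realType) (f : R -> R) (a M : R) :
  0 <= a -> measurable_fun `[a, +oo[ f -> (forall t, a <= t -> 0 <= f t) ->
  (forall b, (@lebesgue_measure R).-integrable `[a, b] (EFin \o f)) ->
  (\int[@lebesgue_measure R]_(x in `[a, +oo[) (f x)%:E = +oo)%E ->
  exists N, forall t, N <= t ->
    M <= (\int[@lebesgue_measure R]_(x in `[a, t]) f x)%R.
Proof.
move=> a0 f_meas f_ge0 f_int f_oo.
pose g := f \_ `[a, +oo[.
have g_ge0 t : 0 <= g t.
  by rewrite /g patchE; case: ifPn => //; rewrite inE/= in_itv/= andbT => /f_ge0.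
have g_meas : measurable_fun setT g.
  by apply/(measurable_restrictT f) => //.
have gE (b : itv_bound R) :
    (\int[@lebesgue_measure R]_(x in [set` Interval (BLeft 0%R) b]) (g x)%:E
    = \int[@lebesgue_measure R]_(x in [set` Interval (BLeft a) b]) (f x)%:E)%E.
  transitivity (\int[@lebesgue_measure R]_(x in [set` Interval (BLeft 0%R) b])
     ((EFin \o f) \_ `[a, +oo[) x)%E.
    by apply: eq_integral => x _; rewrite restrict_EFin.
  rewrite -integral_mkcondr; congr (integral _ _ _).
  apply/seteqP; split => x /=; rewrite !itv_boundlr/= !bnd_simp.
    by move=> [/andP[_ ->]]; rewrite andbT => ->.
  by move=> /andP[ax ->]; rewrite ax (le_trans a0 ax).
have := ge0_integral_ereal_sup (@lebesgue_measure R) g_ge0 g_meas.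
rewrite (gE +oo%O) f_oo => /esym sup_oo.
have : (M%:E < +oo)%E by rewrite ltry.
rewrite -sup_oo => /ereal_sup_gt[_ [i _ <-]].
rewrite (gE (BRight i.+1%:R)) => Mi.
exists i.+1%:R => t it.
rewrite -lee_fin /Rintegral fineK; last exact: integrable_fin_num.
apply: (le_trans (ltW Mi)); apply: ge0_subset_integral => //.
- by have /integrableP[] := f_int t.
- by move=> x /=; rewrite in_itv/= => /andP[ax _]; rewrite lee_fin f_ge0.
- by apply: subset_itvl; rewrite bnd_simp.
Qed.

(** With [f] the contraction rate, this converts the losses at integer steps into the integral whose
    divergence is assumed. *)
Lemma integral_step_le (R : realType) (f : R -> R) (a t : R) :
  a <= t -> (forall b, (@lebesgue_measure R).-integrable `[a, b] (EFin \o f)) ->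
  (forall s, t <= s -> f s <= f t) ->
  (\int[@lebesgue_measure R]_(x in `[a, (t + 1)%R]) f x
   <= \int[@lebesgue_measure R]_(x in `[a, t]) f x + f t)%R.
Proof.
move=> at_ f_int f_decr.
have t1 : t <= t + 1 by rewrite lerDl.
rewrite -lerBlDl Rintegral_itvB//.
have mu1 : fine (@lebesgue_measure R `]t, (t + 1)%R]) = 1.
  by rewrite lebesgue_measure_itv/= lte_fin ltrDl ltr01 -EFinD/= addrAC subrr add0r.
have -> : f t = (\int[@lebesgue_measure R]_(x in `]t, (t + 1)%R]) (cst (f t) x))%R.
  by rewrite Rintegral_cst// mu1 mulr1.
have cst_int : (@lebesgue_measure R).-integrable `[t, (t + 1)%R]
    (EFin \o cst (f t)).
  apply: continuous_compact_integrable; first exact: segment_compact.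
  by apply: continuous_subspaceT; exact: cst_continuous.
apply: le_Rintegral => //.
- by apply: integrableS (f_int (t + 1)) => //; apply: subset_itvr; rewrite bnd_simp.
- by apply: integrableS cst_int => //; apply: subset_itvr; rewrite bnd_simp.
- by move=> x /=; rewrite in_itv/= => /andP[/ltW tx _]; exact: f_decr.
Qed.

(** * Decay of powers of the solution *)

(** Concave and increasing for [k > 0]. For [k = z / c0 + 1] it satisfies
    [c0 S'' + z S' = - c0 k exp (- k (s - l))]; the added 1 keeps this negative even if [z = 0]. *)
Definition barrier (R : realType) (k l s : R) : R := 2 - expR (- (k * (s - l))).

Lemma barrier_ge1 (R : realType) (k l s : R) : 0 <= k -> l <= s -> 1 <= barrier k l s.
Proof.
move=> k0 ls; have : expR (- (k * (s - l))) <= 1.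
  by rewrite -expR0 ler_expR oppr_le0 mulr_ge0// subr_ge0.
by rewrite /barrier; lra.
Qed.

Lemma barrier_le2 (R : realType) (k l s : R) : barrier k l s <= 2.
Proof. by rewrite /barrier; have := expR_ge0 (- (k * (s - l))); lra. Qed.

(** This is what allows the bound at the end of one time interval to serve as initial bound for the
    next, where the drift and hence [k] are larger. *)
Lemma barrier_le (R : realType) (k k' l s : R) :
  k <= k' -> l <= s -> barrier k l s <= barrier k' l s.
Proof.
by move=> kk' ls; rewrite lerD2l lerN2 ler_expR lerN2 ler_wpM2r// subr_ge0.
Qed.

Lemma is_derive_expR_affine (R : realType) (c k l s : R) :
  is_derive s 1 (fun s : R => c * expR (- (k * (s - l))))
    (- k * c * expR (- (k * (s - l)))).
Proof.
have lP : is_derive s 1 (fun s : R => - (k * (s - l))) (- k).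
  by apply: is_derive_affine => h; ring.
have d := @is_derive1_comp _ expR (fun s => - (k * (s - l))) s _ _ (is_derive_expR _) lP.
by apply: (is_derive_eq (is_deriveZ c d)); rewrite /GRing.scale /=; ring.
Qed.

Lemma is_derive_barrier (R : realType) (k l s : R) :
  is_derive s 1 (barrier k l) (k * expR (- (k * (s - l)))).
Proof.
have d := is_deriveD (is_derive_cst (2 : R) s 1) (is_derive_expR_affine (-1) k l s).
have -> : barrier k l = cst 2 + (fun s : R => -1 * expR (- (k * (s - l)))).
  by apply/funext => r; rewrite /barrier !fctE mulN1r.
by apply: (is_derive_eq d); ring.
Qed.

Lemma is_derive_powR2 (R : realType) (p s : R) : 0 < s ->
  is_derive s 1 (fun s => p * s `^ (p - 1)) (p * (p - 1) * s `^ (p - 2)).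
Proof.
move=> s0; have d := is_deriveZ p (is_derive1_powR (p - 1) s0).
apply: (is_derive_eq d); rewrite /GRing.scale /= mulrA.
by congr (_ * _ `^ _); lra.
Qed.

(** The comparison function is [W + Q S + int g] with [Q] decreasing linearly at rate [Y * be]. As
    [S <= 2], this decrease costs at most [2 Y be]; as [be <= 1 / 4], [Q] stays above [3 Y / 4], and
    the barrier gains at least [3 / 4 * Y * (4 * be) = 3 Y be]. The difference makes the inequality
    strict, while [g] absorbs the source. *)
Lemma slab_step (R : realType) (n : nat) (U : set 'cV[R]_n)
    (A : 'cV[R]_n -> R -> 'M[R]_n) (K : 'cV[R]_n -> R -> 'M[R]_n)
    (B : 'cV[R]_n -> R -> R -> 'cV[R]_n) (c0 c1 c2 : R)
    (u f : 'cV[R]_n -> R -> R) (F g : R -> R) (z p : R) (i : 'I_n)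
    (a l d k be Y W : R) :
  log_solution U A K B c0 c1 c2 u f ->
  0 <= p * (p - 1) -> 0 <= p * ((p - 1) * c0 - c1) -> 0 <= p * ((p - 1) * c0 + c2) ->
  0 <= a ->
  (forall x t, U x -> a < t -> t <= a + 1 -> `|f x t| <= F t) ->
  (forall x t, U x -> a < t -> t <= a + 1 -> enorm (B x t (u x t)) <= z) ->
  (forall x t, U x -> a < t -> t <= a + 1 ->
    `|p * u x t `^ (p - 1)| * F t <= g t) ->
  {within `[a, a + 2], continuous g} -> (forall t, a <= t -> 0 <= g t) ->
  (forall x, closure U x -> l <= x i 0 /\ x i 0 - l <= d) ->
  0 <= z -> k = z / c0 + 1 -> 0 < be -> be <= 1 / 4 ->
  4 * be <= k * c0 * expR (- (k * d)) -> 0 < Y ->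
  (forall x, closure U x -> u x a `^ p <= W + Y * barrier k l (x i 0)) ->
  (forall x t, boundary U x -> a <= t -> t <= a + 1 -> u x t `^ p <= W) ->
  forall x t, closure U x -> a <= t -> t <= a + 1 ->
    u x t `^ p <= W + Y * (1 - be * (t - a)) * barrier k l (x i 0)
      + \int[@lebesgue_measure R]_(s in `[a, t]) g s.
Proof.
move=> sol p1 p2 p3 a0 f_bnd B_bnd g_bnd g_cont g_ge0 l_bnd z0 kE be0 be4 bek Y0
  init bdry x t Ux at_ ta.
have c00 := sol_c0_gt0 sol.
have k0 : 0 < k by rewrite kE ltr_wpDl// divr_ge0// ltW.
have ckz : c0 * k = z + c0 by rewrite kE mulrDr mulr1 mulrCA divff ?mulr1 ?gt_eqF.
pose Q t := Y * (1 - be * (t - a)).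
pose H t := W + (\int[@lebesgue_measure R]_(s in `[a, t]) g s)%R.
pose E s := expR (- (k * (s - l))).
have QP (r : R) : is_derive r 1 Q (- (Y * be)).
  by apply: is_derive_affine => h; rewrite /Q; ring.
have g_cont1 : {within `[a, a + 1], continuous g}.
  by apply: continuous_subspaceW g_cont; apply: subset_itvl; rewrite bnd_simp; lra.
have Qpos r : r <= a + 1 -> Y * (3 / 4) <= Q r.
  move=> ra; rewrite /Q ler_wpM2l ?(ltW Y0)//.
  have [ar|ra'] := leP a r; last by nra.
  have : be * (r - a) <= 1 / 4 * 1 by apply: ler_pM => //; lra.
  lra.
suff : u x t `^ p <= Q t * barrier k l (x i 0) + H t by rewrite /H addrCA addrA.
apply: (@comparison _ _ U A K B c0 c1 c2 u f F z (fun s => s `^ p)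
  (fun s => p * s `^ (p - 1)) (fun s => p * (p - 1) * s `^ (p - 2)) i
  (barrier k l) (fun s => k * E s) (fun s => - k * k * E s) Q H
  (fun=> - (Y * be)) g a (a + 1) sol a0 _ f_bnd
  (fun x t Ux at_ ta => or_intror (B_bnd x t Ux at_ ta))
  (fun s s0 => is_derive1_powR p s0) (fun s s0 => is_derive_powR2 p s0)
  (is_derive_barrier k l) (is_derive_expR_affine k k l) _ _ (fun r _ _ => QP r)).
- by rewrite lerDl.
- by move=> s; rewrite mulr_ge0 ?expR_ge0// ltW.
- by move=> s; rewrite mulr_le0_ge0 ?expR_ge0// mulNr oppr_le0 mulr_ge0// ltW.
- move=> r ar ra.
  (* The primitive is differentiated up to and including [a + 1], hence the continuity of [g] on the
     longer segment up to [a + 2]. *)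
  have d1 := is_deriveD (is_derive_cst W r 1) (is_derive_primitive ar
     (le_lt_trans ra (ltac:(lra) : a + 1 < a + 2)) g_cont).
  by apply: (is_derive_eq d1); rewrite add0r.
- apply: continuous_subspaceT => r; have [/derivable1_diffP + _] := QP r.
  exact: differentiable_continuous.
- apply: within_continuousD; first by apply: continuous_subspaceT; exact: cst_continuous.
  by apply: continuous_primitive => //; rewrite lerDl.
- by move=> r ar ra; apply: le_trans (Qpos _ ra); rewrite mulr_ge0// ltW.
(* After factoring out [s^(p-2)], the sign of [p] decides whether the lower or the upper bound on
   [ka] is the relevant one. *)
- left => s al ka e s0 e0 al_ge /andP[ka1 ka2].
  have -> : s `^ (p - 2) = s `^ (p - 1) / s.
    rewrite -[s in _ / s]powRr1 ?ltW// -powRB; last by apply/implyP => _; rewrite gt_eqF.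
    by congr (_ `^ _); lra.
  have -> : p * (p - 1) * (s `^ (p - 1) / s) * al + p * s `^ (p - 1) / s * ka
    = s `^ (p - 1) / s * (p * (p - 1) * al + p * ka) by field; rewrite gt_eqF.
  rewrite mulr_ge0// ?divr_ge0 ?powR_ge0 ?(ltW s0)//.
  have q1 : p * (p - 1) * (c0 * e) <= p * (p - 1) * al by rewrite ler_wpM2l.
  have [pp|pp] := leP 0 p.
    have := ler_wpM2l pp ka1; have := mulr_ge0 p2 e0; lra.
  have := ler_wnM2l (ltW pp) ka2; have := mulr_ge0 p3 e0; lra.
- move=> y r Uy ar ra; have Uy' := subset_closure Uy.
  have [ly yd] := l_bnd _ Uy'.
  have gy := g_bnd _ _ Uy ar ra.
  have Q34 := Qpos _ ra.
  have S2 := barrier_le2 k l (y i 0).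
  have E_ge : expR (- (k * d)) <= E (y i 0).
    by rewrite ler_expR lerN2 ler_wpM2l// ltW.
  have e1 : c0 * (- k * k * E (y i 0)) + z * (k * E (y i 0)) = - (k * c0 * E (y i 0)).
    have -> : c0 * (- k * k * E (y i 0)) = - (c0 * k * k * E (y i 0)) by ring.
    by rewrite ckz; ring.
  rewrite e1.
  have e2 : 4 * be <= k * c0 * E (y i 0).
    apply: (le_trans bek); rewrite ler_wpM2l// mulr_ge0 ?ltW//.
  have e3 : Y * (3 / 4) * (4 * be) <= Q r * (k * c0 * E (y i 0)).
    by apply: ler_pM => //; rewrite mulr_ge0 ?ltW.
  have Ybe : 0 < Y * be by exact: mulr_gt0.
  have : Y * be * barrier k l (y i 0) <= Y * be * 2 by rewrite ler_wpM2l// ltW.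
  lra.
- move=> y Uy; rewrite /H set_itv1 Rintegral_set1 addr0 /Q subrr mulr0 subr0 mulr1.
  by rewrite addrC; exact: init.
- move=> y r Uy ar ra; apply: (le_trans (bdry _ _ Uy ar ra)).
  have Uy' : closure U y by case: Uy.
  have [ly _] := l_bnd _ Uy'.
  have S1 := barrier_ge1 (ltW k0) ly.
  rewrite /H addrCA lerDl addr_ge0//.
    by rewrite mulr_ge0//; [apply: le_trans (Qpos _ ra); rewrite mulr_ge0// ltW|lra].
  by apply: Rintegral_ge0 => s /=; rewrite in_itv/= => /andP[as_ _]; exact: g_ge0.
- exact: Ux.
- exact: at_.
- exact: ta.
Qed.

Lemma bounded_on_slab (R : realType) (n : nat) (U : set 'cV[R]_n)
    (u : 'cV[R]_n -> R -> R) (Phi : R -> R) (a b : R) :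
  bounded_set U -> cont_on (ccyl U) u -> (forall x t, ccyl U (x, t) -> 0 < u x t) ->
  (forall s : R, 0 < s -> {for s, continuous Phi}) -> 0 <= a ->
  exists2 M, 0 <= M & forall x t, closure U x -> a <= t -> t <= b ->
    `|Phi (u x t)| <= M.
Proof.
move=> U_bnd u_cont u_pos PhiC a0; pose C := closure U `*` `[a, b].
have C_cpt : compact C.
  by apply: compact_setX; [exact: compact_closure|exact: segment_compact].
have CC p : C p -> ccyl U p.
  case: p => y s [/= Uy]; rewrite in_itv/= => /andP[as_ _].
  by split=> //=; exact: le_trans as_.
have fC : {within C, continuous (fun p : 'cV[R]_n * R => Phi (u p.1 p.2))}.
  apply/subspace_continuousP => -[y s] Cys.
  have /subspace_continuousP/(_ _ Cys) uC := continuous_subspaceW CC u_cont.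
  apply: (@cvg_comp _ _ _ (fun p : 'cV[R]_n * R => u p.1 p.2) Phi _ _ _ uC).
  by apply: PhiC; apply: u_pos; exact: CC.
have /compact_bounded[M [_ MP]] := continuous_compact fC C_cpt.
exists (`|M| + 1); first by rewrite addr_ge0.
move=> x t Ux at_ tb; apply: MP; first by rewrite ltr_pwDr// ler_norm.
by exists (x, t) => //; split; rewrite //= in_itv/= at_.
Qed.

(* On [N + j, N + j + 1] the bound is [W + (e + M exp (- c int rho)) S_j]; the
   barriers [S_j] increase with [j], and the per-step loss factor is
   [1 - be <= exp (- be)] with [be] proportional to [rho] at the right end. *)
Lemma power_decay (R : realType) (n : nat) (U : set 'cV[R]_n)
    (A : 'cV[R]_n -> R -> 'M[R]_n) (K : 'cV[R]_n -> R -> 'M[R]_n)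
    (B : 'cV[R]_n -> R -> R -> 'cV[R]_n) (c0 c1 c2 : R)
    (u f : 'cV[R]_n -> R -> R) (F g zf I : R -> R) (p : R) (i : 'I_n)
    (l d T W : R) :
  log_solution U A K B c0 c1 c2 u f ->
  0 <= p * (p - 1) -> 0 <= p * ((p - 1) * c0 - c1) -> 0 <= p * ((p - 1) * c0 + c2) ->
  0 <= T -> 0 <= d ->
  (forall x t, U x -> T < t -> `|f x t| <= F t) ->
  (forall x t, U x -> T < t -> enorm (B x t (u x t)) <= zf t) ->
  (forall x t, U x -> T < t -> `|p * u x t `^ (p - 1)| * F t <= g t) ->
  (forall a b, T <= a -> {within `[a, b], continuous g}) ->
  (forall t, T <= t -> 0 <= g t) ->
  (forall x, closure U x -> l <= x i 0 /\ x i 0 - l <= d) ->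
  (forall s t, T <= s -> s <= t -> zf s <= zf t) -> (forall t, T <= t -> 0 <= zf t) ->
  (forall t, T <= t -> I (t + 1) <= I t + expR (- (d / c0 * zf t))) ->
  (forall M : R, exists N, forall t, N <= t -> M <= I t) ->
  (forall e, 0 < e -> exists N, forall t, N <= t ->
     \int[@lebesgue_measure R]_(s in `[t, (t + 1)%R]) g s
     <= e * expR (- (d / c0 * zf (t + 1)))) ->
  (forall e, 0 < e -> exists N, forall x t, boundary U x -> N <= t ->
     u x t `^ p <= W + e) ->
  forall e, 0 < e -> exists N, forall x t, closure U x -> N <= t ->
     u x t `^ p <= W + e.
Proof.
move=> sol p1 p2 p3 T0 d0 f_bnd B_bnd g_bnd g_cont g_ge0 l_bnd zf_incr zf_ge0
  I_step I_oo g_small bdry e e0.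
have c00 := sol_c0_gt0 sol.
(* Final count: [e'] from the boundary, [2 Y <= 3 e'] from the barrier, and at most [e' / 4] from
   the source. *)
pose e' := e / 5; have e'0 : 0 < e' by rewrite divr_gt0.
(* [cb] has to give both [4 * be <= k * c0 * expR (- (k * d))], where [k >= 1], and [be <= 1 / 4];
   the minimum with 1 serves the second. The factor [expR (- d)] stems from the 1 in [k]. *)
pose cm := Num.min c0 1; have cm0 : 0 < cm by rewrite lt_min c00 ltr01.
pose cb := cm / 4 * expR (- d).
have cb0 : 0 < cb by rewrite mulr_gt0 ?expR_gt0// divr_gt0.
pose rho t := expR (- (d / c0 * zf t)).
have rho_gt0 t : 0 < rho t by exact: expR_gt0.
have rho_le1 t : T <= t -> rho t <= 1.
  move=> Tt; rewrite -expR0 ler_expR oppr_le0 mulr_ge0 ?zf_ge0//.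
  by rewrite divr_ge0// ltW.
have ed1 : expR (- d) <= 1 by rewrite -expR0 ler_expR oppr_le0.
have [N1 N1P] := g_small (e' * cb) (mulr_gt0 e'0 cb0).
have [N2 N2P] := bdry _ e'0.
pose N := Num.max T (Num.max N1 N2).
have TN : T <= N by rewrite le_max lexx.
have N1N : N1 <= N by rewrite !le_max lexx orbT.
have N2N : N2 <= N by rewrite !le_max lexx !orbT.
have N0 : 0 <= N by exact: le_trans TN.
have [M M0 MP] : exists2 M, 0 <= M & forall x, closure U x -> u x N `^ p <= W + e' + M.
  have PC (s : R) : 0 < s -> {for s, continuous (fun s => s `^ p)}.
    move=> s0; have [/derivable1_diffP + _] := is_derive1_powR p s0.
    exact: differentiable_continuous.
  have [M M0 MP] := bounded_on_slab N (sol_domain_bounded sol) (sol_cont sol)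
    (sol_pos sol) PC N0.
  exists (M + `|W + e'|); first exact: addr_ge0.
  move=> x Ux; have := MP x N Ux (lexx _) (lexx _).
  have := ler_norm (u x N `^ p); have := ler_norm (- (W + e')); rewrite normrN; lra.
have TNj j : T <= N + j%:R by apply: (le_trans TN); rewrite lerDl.
pose k j := zf (N + j%:R + 1) / c0 + 1.
pose be j := cb * rho (N + j%:R + 1).
(* The shift by one matches [be j]: the rate at [N + j + 1], the right end of step [j], bounds the
   increase of [I] over the following unit interval. *)
pose E j := expR (- (cb * (I (N + j%:R + 1) - I (N + 1)))).
pose Y j := e' + M * E j.
have E0 j : 0 < E j by exact: expR_gt0.
have Y0 j : 0 < Y j by rewrite ltr_wpDr// mulr_ge0// ltW.
have be0 j : 0 < be j by rewrite mulr_gt0.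
have TNj1 j : T <= N + j%:R + 1 by apply: (le_trans (TNj j)); rewrite lerDl.
have be4 j : be j <= 1 / 4.
  rewrite /be /cb -mulrA.
  have r1 : expR (- d) * rho (N + j%:R + 1) <= 1 * 1.
    apply: ler_pM; [exact: expR_ge0|exact: expR_ge0|exact: ed1|].
    exact: rho_le1.
  have r2 : cm <= 1 by rewrite ge_min lexx orbT.
  have r3 : cm / 4 * (expR (- d) * rho (N + j%:R + 1)) <= (1 / 4) * (1 * 1).
    apply: ler_pM => //; first by rewrite divr_ge0// ltW.
      by rewrite mulr_ge0 ?expR_ge0// ltW.
    by rewrite ler_wpM2r.
  by move: r3; rewrite !mulr1.
have k1 j : 1 <= k j by rewrite /k lerDr divr_ge0 ?zf_ge0// ltW.
have bek j : 4 * be j <= k j * c0 * expR (- (k j * d)).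
  have -> : expR (- (k j * d)) = expR (- d) * rho (N + j%:R + 1).
    by rewrite -expRD; congr expR; rewrite /k; ring.
  have -> : 4 * be j = cm * (expR (- d) * rho (N + j%:R + 1)) by rewrite /be /cb; field.
  apply: ler_wpM2r; first by apply: mulr_ge0; exact: expR_ge0.
  apply: (@le_trans _ _ c0); first by rewrite ge_min lexx.
  by rewrite ler_peMl// ltW.
have key j : (forall x, closure U x ->
      u x (N + j%:R) `^ p <= W + e' + Y j * barrier (k j) l (x i 0)) ->
    forall x t, closure U x -> N + j%:R <= t -> t <= N + j%:R + 1 ->
      u x t `^ p <= W + e' + Y j * (1 - be j * (t - (N + j%:R))) * barrier (k j) l (x i 0)
      + \int[@lebesgue_measure R]_(s in `[N + j%:R, t]) g s.
  move=> init; have Tj := TNj j; have T1j := TNj1 j.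
  apply: (@slab_step _ _ U A K B c0 c1 c2 u f F g (zf (N + j%:R + 1)) p i
    (N + j%:R) l d (k j) (be j) (Y j) (W + e') sol) => //.
  - exact: le_trans Tj.
  - by move=> x t Ux Nt _; apply: f_bnd => //; exact: le_lt_trans Nt.
  - move=> x t Ux Nt tN; have Tt : T < t by exact: le_lt_trans Nt.
    by apply: (le_trans (B_bnd _ _ Ux Tt)); apply: zf_incr => //; exact: ltW.
  - by move=> x t Ux Nt _; apply: g_bnd => //; exact: le_lt_trans Nt.
  - exact: g_cont.
  - by move=> t Nt; apply: g_ge0; exact: le_trans Nt.
  - exact: zf_ge0.
  - move=> x t Ux Nt _; apply: N2P => //; apply: (le_trans N2N).
    by apply: le_trans Nt; rewrite lerDl.
have g_int j t : N + j%:R <= t -> t <= N + j%:R + 1 ->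
    \int[@lebesgue_measure R]_(s in `[N + j%:R, t]) g s <= e' * be j.
  move=> Nt tN.
  have : \int[@lebesgue_measure R]_(s in `[N + j%:R, (N + j%:R + 1)%R]) g s <= e' * be j.
    by rewrite /be mulrA; apply: N1P; apply: (le_trans N1N); rewrite lerDl.
  apply: le_trans.
  have gI b : (@lebesgue_measure R).-integrable `[N + j%:R, b] (EFin \o g).
    by apply: continuous_compact_integrable; [exact: segment_compact|exact: g_cont].
  have := Rintegral_itvB (gI (N + j%:R + 1)) (_ : (BLeft (N + j%:R) <= BRight t)%O)
    (_ : (BRight t <= BRight (N + j%:R + 1))%O).
  rewrite !bnd_simp => /(_ Nt tN) gB.
  rewrite -subr_ge0 gB; apply: Rintegral_ge0 => s /=; rewrite in_itv/= => /andP[ts _].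
  by apply: g_ge0; apply: (le_trans (TNj j)); apply: (le_trans Nt); exact: ltW.
have claim j : forall x, closure U x ->
    u x (N + j%:R) `^ p <= W + e' + Y j * barrier (k j) l (x i 0).
  elim: j => [|j IH] x Ux; have [lx xd] := l_bnd _ Ux.
    rewrite addr0; apply: (le_trans (MP _ Ux)); rewrite lerD2l.
    have -> : Y 0%N = e' + M by rewrite /Y /E addr0 subrr mulr0 oppr0 expR0 mulr1.
    have S1 := barrier_ge1 (le_trans ler01 (k1 0%N)) lx.
    apply: (@le_trans _ _ (e' + M)); first by rewrite lerDr ltW.
    by rewrite ler_peMr// addr_ge0// ltW.
  have NjS : N + j.+1%:R = N + j%:R + 1 by rewrite -natr1 addrA.
  have NjN : N + j%:R <= N + j.+1%:R by rewrite NjS lerDl.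
  have := key _ IH x _ Ux NjN; rewrite {1}NjS => /(_ (lexx _)).
  have -> : N + j.+1%:R - (N + j%:R) = 1 by rewrite NjS; ring.
  have := g_int j _ NjN; rewrite {1}NjS => /(_ (lexx _)).
  move: (\int[_]_(_ in _) _)%R => J.
  have S1 := barrier_ge1 (le_trans ler01 (k1 j)) lx.
  have kk : k j <= k j.+1.
    rewrite lerD2r ler_wpM2r ?invr_ge0 ?(ltW c00)// zf_incr//.
    by rewrite NjS lerDl.
  have SS := barrier_le kk lx.
  have EE : E j * (1 - be j) <= E j.+1.
    apply: (@le_trans _ _ (E j * expR (- be j))).
      by rewrite ler_wpM2l ?(ltW (E0 _))// expR_ge1Dx.
    rewrite -expRD ler_expR NjS /be.
    have := I_step _ (TNj1 j); rewrite -/(rho _) => Is.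
    have := ler_wpM2l (ltW cb0) Is; lra.
  (* The source of one step is at most [e' * be j], exactly what the contraction takes from the
     constant part [e'] of [Y j]; the part [M * E j] decays freely. *)
  have YY : Y j * (1 - be j) + e' * be j <= Y j.+1.
    have := ler_wpM2l M0 EE; rewrite /Y; lra.
  have ebe : 0 <= e' * be j by rewrite mulr_ge0// ltW.
  have h1 := ler_wpM2l ebe S1.
  have h2 : (Y j * (1 - be j) + e' * be j) * barrier (k j) l (x i 0)
      <= Y j.+1 * barrier (k j.+1) l (x i 0).
    apply: ler_pM => //; last exact: le_trans S1.
    by rewrite addr_ge0// mulr_ge0 ?(ltW (Y0 _))//; have := be4 j; lra.
  by rewrite mulr1; lra.
(* Once [I] has grown by [y / cb], [exp y >= 1 + y] gives [E j <= 1 / (1 + y)], whence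
   [M * E j <= e' / 2]. *)
pose y := 2 * M / e'.
have y0 : 0 <= y by rewrite divr_ge0 ?mulr_ge0// ltW.
have [N3 N3P] := I_oo (I (N + 1) + y / cb).
exists (Num.max N N3) => x t Ux; rewrite ge_max => /andP[Nt N3t].
pose j := Num.truncn (t - N).
have /andP[jt tj] : j%:R <= t - N < j.+1%:R by apply: truncn_itv; rewrite subr_ge0.
have Njt : N + j%:R <= t by lra.
have tNj : t <= N + j%:R + 1 by move: tj; rewrite -natr1; lra.
have := key _ (claim j) x t Ux Njt tNj.
have := g_int j t Njt tNj.
move: (\int[_]_(_ in _) _)%R => J.
have [lx xd] := l_bnd _ Ux.
have S2 := barrier_le2 (k j) l (x i 0).
have S1 := barrier_ge1 (le_trans ler01 (k1 j)) lx.
have ME : M * E j <= e' / 2.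
  have Iy : y <= cb * (I (N + j%:R + 1) - I (N + 1)).
    by rewrite mulrC -ler_pdivrMr// lerBrDl; apply: N3P; exact: le_trans N3t tNj.
  have E1 : E j * (1 + y) <= 1.
    rewrite -ler_pdivlMr ?ltr_wpDr// div1r -[E j]invrK lef_pV2 ?posrE ?invr_gt0//.
      by rewrite /E expRN invrK; apply: le_trans (expR_ge1Dx _) _; rewrite ler_expR.
    by rewrite ltr_wpDr.
  have := ler_wpM2l (ltW e'0) E1.
  have -> : e' * (E j * (1 + y)) = e' * E j + 2 * (M * E j).
    by rewrite /y; field; rewrite gt_eqF.
  have := mulr_ge0 (ltW e'0) (ltW (E0 j)); lra.
have tt0 : 0 <= be j * (t - (N + j%:R)) by rewrite mulr_ge0 ?(ltW (be0 _))//; lra.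
have q1 : Y j * (1 - be j * (t - (N + j%:R))) * barrier (k j) l (x i 0) <= Y j * 1 * 2.
  apply: (@le_trans _ _ (Y j * 1 * barrier (k j) l (x i 0))).
    rewrite ler_wpM2r ?(le_trans ler01 S1)// ler_wpM2l ?(ltW (Y0 _))//; lra.
  by rewrite ler_wpM2l// mulr1 ltW.
have q2 : e' * be j <= e' * (1 / 4) by rewrite ler_wpM2l ?(ltW e'0)// be4.
have eE : e = 5 * e' by rewrite /e'; field.
by rewrite eE; move: q1; rewrite /Y; lra.
Qed.

(** Comparison of [u] with a function of time alone: at a maximum the spatial gradient is zero, so
    neither the size of the drift nor the sign of the quadratic term matters, and only the source
    feeds the growth. *)
Lemma sup_growth (R : realType) (n : nat) (U : set 'cV[R]_n)
    (A : 'cV[R]_n -> R -> 'M[R]_n) (K : 'cV[R]_n -> R -> 'M[R]_n)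
    (B : 'cV[R]_n -> R -> R -> 'cV[R]_n) (c0 c1 c2 : R)
    (u f : 'cV[R]_n -> R -> R) (F : R -> R) (i : 'I_n) (a C : R) :
  log_solution U A K B c0 c1 c2 u f -> 0 < a ->
  {within [set t : R | 0 <= t], continuous F} -> (forall t, 0 <= t -> 0 <= F t) ->
  (forall x t, cyl U (x, t) -> `|f x t| <= F t) ->
  (forall x, closure U x -> u x a <= C) ->
  (forall x t, boundary U x -> a <= t -> u x t <= C) ->
  forall x t, closure U x -> a <= t ->
    u x t <= C + 1 + \int[@lebesgue_measure R]_(s in `[0, t]) F s.
Proof.
move=> sol a0 F_cont F_ge0 f_bnd init bdry x t Ux at_.
have int_ge0 r : 0 <= \int[@lebesgue_measure R]_(s in `[0, r]) F s.
  by apply: Rintegral_ge0 => s /=; rewrite in_itv/= => /andP[s0 _]; exact: F_ge0.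
have [->|ta] := eqVneq t a.
  by apply: (le_trans (init _ Ux)); rewrite -addrA lerDl addr_ge0.
have {ta}at1 : a < t by rewrite lt_neqAle eq_sym ta.
have FC (b c : R) : 0 <= b -> {within `[b, c], continuous F}.
  move=> b0; apply: continuous_subspaceW F_cont => s /=; rewrite in_itv/= => /andP[bs _].
  exact: le_trans bs.
(* A linear term of slope [eta] makes the differential inequality strict and has grown to exactly 1
   at time [t]; this is the 1 in the bound, and the reason for treating [t = a] apart. *)
pose eta := (t - a)^-1; have eta0 : 0 < eta by rewrite invr_gt0 subr_gt0.
pose J s := (\int[@lebesgue_measure R]_(r in `[0, s]) F r)%R.
pose lin s := C + eta * (s - a).
pose H s := lin s + J s.
have linP (s : R) : is_derive s 1 lin eta.
  by apply: is_derive_affine => h; rewrite /lin; ring.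
have idP (s : R) : 0 < s -> is_derive s 1 (@id R) 1.
  by move=> _; exact: is_derive_id.
have cstP (c s : R) : is_derive s 1 (fun=> c : R) 0.
  exact: is_derive_cst.
have -> : C + 1 + \int[@lebesgue_measure R]_(s in `[0, t]) F s = 0 * 1 + H t.
  by rewrite mul0r add0r /H /lin mulVf ?gt_eqF ?subr_gt0.
apply: (@comparison _ _ U A K B c0 c1 c2 u f F 0 id (fun=> 1) (fun=> 0) i
  (fun=> 1) (fun=> 0) (fun=> 0) (fun=> 0) H (fun=> 0) (fun s => eta + F s) a t sol
  (ltW a0) at_ _ _ idP (fun s _ => cstP 1 s) (cstP 1) (cstP 0) _ _
  (fun s _ _ => cstP 0 s)).
- by move=> y r Uy ar _; apply: f_bnd; split => //=; exact: lt_trans ar.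
- by left.
- by [].
- by [].
- move=> r ar rt; apply: is_deriveD.
  apply: (@is_derive_primitive _ F 0 (t + 1)); first exact: lt_trans ar.
    by apply: (le_lt_trans rt); rewrite ltrDl.
  exact: FC.
- by apply: continuous_subspaceT; exact: cst_continuous.
- apply: within_continuousD.
    apply: continuous_subspaceT => r; have [/derivable1_diffP + _] := linP r.
    exact: differentiable_continuous.
  apply: (@continuous_subspaceW _ _ _ `[0, t]).
    by apply: subset_itvr; rewrite bnd_simp ltW.
  by apply: continuous_primitive; [apply: le_trans at_; exact: ltW|exact: FC].
- by [].
- by right; split=> // s _; exact: oner_neq0.
- by move=> y r _ _ _; rewrite normr1 mul1r !mul0r addr0 add0r ltrDr.
- move=> y Uy; rewrite mul0r add0r /H /lin subrr mulr0 addr0.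
  by apply: (le_trans (init _ Uy)); rewrite lerDl; exact: int_ge0.
- move=> y r Uy ar rt; rewrite mul0r add0r /H /lin.
  apply: (le_trans (bdry _ _ Uy ar)); rewrite -addrA lerDl addr_ge0//; last exact: int_ge0.
  by rewrite mulr_ge0 ?subr_ge0// ltW.
- exact: Ux.
- exact: at_.
- exact: lexx.
Qed.

Lemma limf_esup0_lt (R : realType) (h : R -> R) (e : R) :
  limf_esup (fun t => (h t)%:E) +oo = 0%E -> 0 < e ->
  exists N, forall t, N <= t -> h t < e.
Proof.
move=> h0 e0; have : (limf_esup (fun t => (h t)%:E) +oo%R < e%:E)%E.
  by rewrite h0 lte_fin.
rewrite limf_esupE => /ereal_inf_lt[_ [V [N [_ NV]] <-]] Ve.
exists (N + 1) => t Nt; rewrite -lte_fin; apply: le_lt_trans Ve.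
apply: ereal_sup_ubound; exists t => //; apply: NV.
by apply: lt_le_trans Nt; rewrite ltrDl.
Qed.

Lemma integrable_expRN (R : realType) (z : R -> R) (c a b : R) :
  0 <= c -> measurable_fun `[a, +oo[ z -> (forall t, a <= t -> 0 <= z t) ->
  (@lebesgue_measure R).-integrable `[a, b]
    (EFin \o (fun t => expR (- (c * z t)))).
Proof.
move=> c0 z_meas z_ge0; apply: measurable_bounded_integrable => //.
- rewrite /= lebesgue_measure_itv/=; case: ifP => _; last exact: ltry.
  by rewrite -EFinD ltry.
- apply: (measurableT_comp (@measurable_realfun.measurable_expR R)).
  apply: measurable_realfun.measurable_funN; apply: measurable_realfun.measurable_funM => //.
  by apply: measurable_funS z_meas => //; apply: subset_itvl.
- exists 1; split=> // M M1 t /=; rewrite in_itv/= => /andP[at_ _].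
  rewrite ger0_norm ?expR_ge0// (le_trans _ (ltW M1))//.
  by rewrite -expR0 ler_expR oppr_le0 mulr_ge0// z_ge0.
Qed.

(** A set without a supremum has [sup] equal to 0, so this case is covered as well. *)
Lemma sup_nneg (R : realType) (E : set R) : (forall x, E x -> 0 <= x) -> 0 <= sup E.
Proof.
move=> E0; have [supE|/sup_out->//] := pselect (has_sup E).
have [[x Ex] ubE] := supE.
by apply: (le_trans (E0 _ Ex)); exact: ub_le_sup.
Qed.

(* [1 + u <= C1 Fcal] bounds the drift by a fixed multiple of [bbar Fcal^gamma0],
   so that only one value of [mu] in the hypothesis on (Z) matters. *)
Lemma power_limsup (R : realType) (n : nat) (U : set 'cV[R]_n)
    (A : 'cV[R]_n -> R -> 'M[R]_n) (K : 'cV[R]_n -> R -> 'M[R]_n)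
    (B : 'cV[R]_n -> R -> R -> 'cV[R]_n) (c0 c1 c2 : R)
    (u f : 'cV[R]_n -> R -> R) (F bbar Fcal Lamt : R -> R) (i : 'I_n)
    (gamma0 lambda1 ustar T tF l d C1 : R) :
  log_solution U A K B c0 c1 c2 u f ->
  0 < gamma0 -> 0 < ustar -> 1 <= T -> 0 <= d -> 1 <= C1 -> tF <= T ->
  {within [set t : R | 0 <= t], continuous bbar} ->
  (forall t : R, 0 <= t -> 0 <= bbar t) ->
  (forall s t : R, 0 <= s -> s <= t -> bbar s <= bbar t) ->
  (forall x t (s : R), cyl U (x, t) -> 0 < s ->
     enorm (B x t s) <= bbar t * (1 + `|s|) `^ gamma0) ->
  {within [set t : R | 0 <= t], continuous F} ->
  (forall t : R, 0 <= t -> 0 <= F t) ->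
  (forall x t, cyl U (x, t) -> `|f x t| <= F t) ->
  {within [set t : R | tF <= t], continuous Fcal} ->
  (forall s t : R, tF <= s -> s <= t -> Fcal s <= Fcal t) ->
  (forall t, T <= t -> 1 <= Fcal t) ->
  (forall x t, closure U x -> T <= t -> 1 + u x t <= C1 * Fcal t) ->
  (forall x, closure U x -> l <= x i 0 /\ x i 0 - l <= d) ->
  (forall s t : R, T <= s -> s <= t -> Lamt t <= Lamt s) ->
  (forall t, T <= t -> 0 <= Lamt t) ->
  (forall x t, boundary U x -> T <= t -> `|u x t - ustar| <= Lamt t) ->
  (forall t, T <= t -> \int[@lebesgue_measure R]_(tau in `[t, (t + 1)%R])
     (F tau * Fcal tau `^ lambda1) <= Lamt t) ->
  (forall mu e, 0 < mu -> 0 < e -> exists N, forall t, N <= t ->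
    Lamt (t / 4) * expR (d / c0 * (mu * bbar t * Fcal t `^ gamma0)) < e) ->
  (forall mu, 0 < mu -> exists T1,
     [/\ 0 <= T1, tF <= T1, forall t, T1 <= t -> 0 <= Fcal t &
     (\int[@lebesgue_measure R]_(x in `[T1, +oo[)
        (expR (- (d / c0 * (mu * bbar x * Fcal x `^ gamma0))))%:E = +oo)%E]) ->
  forall p Cg : R, 0 <= p * (p - 1) -> 0 <= p * ((p - 1) * c0 - c1) ->
  0 <= p * ((p - 1) * c0 + c2) -> 0 <= Cg ->
  (forall x t, U x -> T <= t -> `|p * u x t `^ (p - 1)| <= Cg * Fcal t `^ lambda1) ->
  forall e, 0 < e -> exists N, forall x t, closure U x -> N <= t ->
    u x t `^ p <= ustar `^ p + e.
Proof.
move=> sol gamma0_gt0 ustar_gt0 T_ge1 d0 C1_ge1 tFT bbar_cont bbar_ge0 bbar_incr B_bnd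
  F_cont F_ge0 f_bnd Fcal_cont Fcal_incr Fcal_ge1 u_bnd l_bnd Lamt_decr Lamt_ge0 g_bnd
  F_small Lamt_small Zint p Cg p1 p2 p3 Cg0 Cg_bnd.
have c00 := sol_c0_gt0 sol.
have C1_gt0 : 0 < C1 by exact: lt_le_trans C1_ge1.
pose mu := C1 `^ gamma0.
have mu_gt0 : 0 < mu by exact: powR_gt0.
have [T1 [T1_ge0 tFT1 T1Fcal T1int]] := Zint _ mu_gt0.
pose z t := mu * bbar t * Fcal t `^ gamma0.
have z_incr s t : T1 <= s -> s <= t -> z s <= z t.
  move=> T1s st; have s0 : 0 <= s by exact: le_trans T1s.
  have F0 := T1Fcal _ T1s; have F0' := T1Fcal _ (le_trans T1s st).
  rewrite /z ler_pM ?powR_ge0 ?mulr_ge0 ?bbar_ge0 ?(ltW mu_gt0)//.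
    by rewrite ler_wpM2l ?(ltW mu_gt0)// bbar_incr.
  apply: ge0_ler_powR; rewrite ?nnegrE// ?(ltW gamma0_gt0)//.
  by apply: Fcal_incr => //; exact: le_trans T1s.
have z_ge0 t : T1 <= t -> 0 <= z t.
  move=> T1t; rewrite /z mulr_ge0 ?powR_ge0// mulr_ge0 ?(ltW mu_gt0)// bbar_ge0//.
  exact: le_trans T1t.
have ray (a : R) (h : R -> R) : a <= T1 -> {within [set t : R | a <= t], continuous h} ->
    measurable_fun `[T1, +oo[ h.
  move=> aT hC; apply: measurable_realfun.subspace_continuous_measurable_fun => //.
  apply: continuous_subspaceW hC => s /=; rewrite in_itv/= andbT; exact: le_trans.
have z_meas : measurable_fun `[T1, +oo[ z.
  apply: measurable_realfun.measurable_funM.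
    by apply: measurable_realfun.measurable_funM => //; exact: ray bbar_cont.
  apply: (measurableT_comp (measurable_realfun.measurable_powR _)).
  exact: ray Fcal_cont.
have dc0 : 0 <= d / c0 by rewrite divr_ge0// ltW.
pose rho t := expR (- (d / c0 * z t)).
have rho_int b : (@lebesgue_measure R).-integrable `[T1, b] (EFin \o rho).
  exact: integrable_expRN.
pose I t := (\int[@lebesgue_measure R]_(x in `[T1, t]) rho x)%R.
pose T' := Num.max T T1.
have TT' : T <= T' by rewrite le_max lexx.
have T1T' : T1 <= T' by rewrite le_max lexx orbT.
have T'0 : 0 < T' by apply: lt_le_trans TT'; exact: lt_le_trans T_ge1.
have FgC a b : T' <= a ->
    {within `[a, b], continuous (fun t => F t * Fcal t `^ lambda1)}.
  move=> Ta; have sub (c : R) : c <= T' -> `[a, b] `<=` [set t : R | c <= t].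
    move=> cT s /=; rewrite in_itv/= => /andP[as_ _].
    by apply: (le_trans cT); exact: le_trans as_.
  apply/subspace_continuousP => s sab.
  have Ts : T' <= s by exact: (sub T').
  apply: cvgM.
    have := continuous_subspaceW (sub _ (ltW T'0)) F_cont.
    by move/subspace_continuousP; exact.
  have /subspace_continuousP/(_ _ sab) FcalC :=
    continuous_subspaceW (sub _ (le_trans tFT TT')) Fcal_cont.
  apply: (@cvg_comp _ _ _ Fcal (fun s => s `^ lambda1) _ _ _ FcalC).
  have Fs : 0 < Fcal s.
    by apply: (@lt_le_trans _ _ 1) => //; apply: Fcal_ge1; exact: le_trans Ts.
  have [/derivable1_diffP + _] := is_derive1_powR lambda1 Fs.
  exact: differentiable_continuous.
pose g t := Cg * (F t * Fcal t `^ lambda1).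
apply: (@power_decay _ _ U A K B c0 c1 c2 u f F g z I p i l d T' (ustar `^ p) sol
  p1 p2 p3 (ltW T'0) d0).
- by move=> x t Ux Tt; apply: f_bnd; split => //=; exact: lt_trans Tt.
- move=> x t Ux Tt; have Uxc := subset_closure Ux.
  have t0 : 0 < t by exact: lt_trans Tt.
  have tT : T <= t by apply: (le_trans TT'); exact: ltW.
  have ut : 0 < u x t by apply: (sol_pos sol); split => //=; exact: ltW.
  apply: (le_trans (B_bnd _ _ _ _ ut)); first by split.
  rewrite /z -mulrA mulrCA ler_wpM2l ?bbar_ge0 ?(ltW t0)//.
  have F1 := Fcal_ge1 _ tT.
  rewrite -powRM ?(ltW C1_gt0) ?(le_trans ler01)//.
  apply: ge0_ler_powR; rewrite ?nnegrE ?(ltW gamma0_gt0)//.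
  - by rewrite mulr_ge0 ?(ltW C1_gt0)// (le_trans ler01).
  - by rewrite gtr0_norm// u_bnd.
- move=> x t Ux Tt; have tT : T <= t by apply: (le_trans TT'); exact: ltW.
  rewrite /g mulrCA [leRHS]mulrC ler_wpM2r//; first by rewrite F_ge0// ltW// (lt_trans T'0).
  exact: Cg_bnd.
- move=> a b Ta; apply/subspace_continuousP => s sab; apply: cvgM.
    exact: cvg_cst.
  by move/subspace_continuousP: (FgC a b Ta); exact.
- move=> t Tt; rewrite /g mulr_ge0// mulr_ge0 ?powR_ge0// F_ge0//.
  by rewrite ltW// (lt_le_trans T'0).
- exact: l_bnd.
- by move=> s t T's; apply: z_incr; exact: le_trans T's.
- by move=> t T't; apply: z_ge0; exact: le_trans T't.
- move=> t T't; apply: integral_step_le => //; first exact: le_trans T't.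
  move=> s ts; rewrite ler_expR lerN2 ler_wpM2l// z_incr//.
  exact: le_trans T't.
- move=> M; apply: integral_unbounded => //.
  + apply: (measurableT_comp (@measurable_realfun.measurable_expR R)).
    apply: measurable_realfun.measurable_funN.
    exact: measurable_realfun.measurable_funM.
  + by move=> t _; exact: expR_ge0.
- move=> e e0; have Cg1 : 0 < Cg + 1 by rewrite ltr_wpDl.
  (* [Cg + 1] avoids a division by zero when [Cg = 0]. *)
  have [N NP] := Lamt_small _ (e / (Cg + 1)) mu_gt0 (divr_gt0 e0 Cg1).
  exists (Num.max (4 * T') N) => t; rewrite ge_max => /andP[Tt Nt].
  (* The source starts at [t] while the rate is taken at [t + 1]. The smallness of [Lamt] at a
     quarter of the time bridges this: [Lamt t <= Lamt ((t + 1) / 4)], and the latter is small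
     against the rate at [t + 1]. *)
  have tT4 : T' <= (t + 1) / 4 by rewrite ler_pdivlMr// mulrC; lra.
  have tT : T' <= t by lra.
  rewrite RintegralZl//; last first.
    by apply: continuous_compact_integrable; [exact: segment_compact|exact: FgC].
  have L0 := Lamt_ge0 _ (le_trans TT' tT).
  have L1 : Lamt t <= Lamt ((t + 1) / 4).
    apply: Lamt_decr; first exact: le_trans tT4.
    by rewrite ler_pdivrMr//; lra.
  have := F_small _ (le_trans TT' tT).
  move=> /(ler_wpM2l Cg0)/le_trans; apply.
  rewrite expRN ler_pdivlMr ?expR_gt0//.
  have := NP (t + 1) (le_trans Nt (ltac:(lra) : t <= t + 1)); rewrite -/(z (t + 1)).
  rewrite ltr_pdivlMr// => LN.
  apply: le_trans (ltW LN).
  rewrite [leRHS]mulrC [leRHS]mulrA; apply: ler_wpM2r; first exact: expR_ge0.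
  by apply: ler_pM => //; rewrite lerDl.
- move=> e e0.
  have /cvgrPdist_lt/(_ e e0) : {for ustar, continuous (fun s => s `^ p)}.
    have [/derivable1_diffP + _] := is_derive1_powR p ustar_gt0.
    exact: differentiable_continuous.
  move=> /nbhs_ballP[de /= de0 deP].
  (* The exponential weight is at least 1, so [Lamt] itself tends to 0; continuity of the power at
     [ustar] then handles the boundary values. *)
  have [N NP] := Lamt_small 1 de ltr01 de0.
  exists (Num.max (4 * T') N) => x t bx; rewrite ge_max => /andP[Tt Nt].
  have tT4 : T' <= t / 4 by rewrite ler_pdivlMr// mulrC.
  have tT : T' <= t by lra.
  have L1 : Lamt t <= Lamt (t / 4).
    by apply: Lamt_decr; [exact: le_trans tT4|rewrite ler_pdivrMr//; lra].
  have L2 : Lamt (t / 4) < de.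
    apply: le_lt_trans (NP _ Nt).
    have L0 := Lamt_ge0 _ (le_trans TT' tT4).
    apply: ler_peMr => //; rewrite -[leLHS]expR0 ler_expR; apply: mulr_ge0 => //.
    rewrite mul1r mulr_ge0 ?powR_ge0// bbar_ge0//.
    by rewrite ltW// (lt_le_trans T'0).
  have := deP (u x t).
  have L3 := le_lt_trans (g_bnd _ _ bx (le_trans TT' tT)) (le_lt_trans L1 L2).
  rewrite -ball_normE /ball_ /= distrC => /(_ L3).
  by rewrite ltr_distlC => /andP[? ?]; rewrite ltW// addrC; lra.
Qed.

(** * Convergence to [ustar] from above and from below *)

Unset Implicit Arguments.

Theorem theorem5p9 (R : realType) (n : nat) (hn : (1 <= n)%N)
  (U : set 'cV[R]_n)
  (U_neq0 : U !=set0) (U_open : open U) (U_bounded : bounded_set U)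
  (A : 'cV[R]_n -> R -> 'M[R]_n) (K : 'cV[R]_n -> R -> 'M[R]_n)
  (B : 'cV[R]_n -> R -> R -> 'cV[R]_n)
  (c0 M1 c1 c2 : R)
  (c0_gt0 : 0 < c0) (M1_gt0 : 0 < M1) (c1_ge0 : 0 <= c1) (c2_ge0 : 0 <= c2)
  (A_sym : forall x t, cyl U (x, t) -> (A x t)^T = A x t)
  (A_ell : forall x t (xi : 'cV[R]_n), cyl U (x, t) ->
     c0 * enorm xi ^+ 2 <= dotp xi (A x t *m xi))
  (A_tr : forall x t, cyl U (x, t) -> \tr (A x t) <= M1)
  (K_bnd : forall x t (xi : 'cV[R]_n), cyl U (x, t) ->
     - c1 * enorm xi ^+ 2 <= dotp xi (K x t *m xi) <= c2 * enorm xi ^+ 2)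
  (u f g : 'cV[R]_n -> R -> R) (u0 : 'cV[R]_n -> R)
  (u_cont : cont_on (ccyl U) u) (u_C21 : C21 U u)
  (u_pos : forall x t, cyl U (x, t) -> 0 < u x t)
  (u_eq : forall x t, cyl U (x, t) -> Lop (@ln R) A B K u x t = f x t)
  (u_bdry : forall (x : 'cV[R]_n) (t : R), boundary U x -> 0 < t -> u x t = g x t)
  (u_init : forall x, U x -> u x 0 = u0 x)
  (bbar : R -> R) (gamma0 : R)
  (bbar_cont : {within [set t : R | 0 <= t], continuous bbar})
  (bbar_ge0 : forall t : R, 0 <= t -> 0 <= bbar t)
  (bbar_incr : forall s t : R, 0 <= s -> s <= t -> bbar s <= bbar t)
  (bbar_lim : bbar t @[t --> +oo] --> +oo)
  (gamma0_gt0 : 0 < gamma0)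
  (B_bnd : forall x t (s : R), cyl U (x, t) -> 0 < s ->
     enorm (B x t s) <= bbar t * (1 + `|s|) `^ gamma0)
  (F : R -> R)
  (F_cont : {within [set t : R | 0 <= t], continuous F})
  (F_ge0 : forall t : R, 0 <= t -> 0 <= F t)
  (f_bnd : forall x t, cyl U (x, t) -> `|f x t| <= F t)
  (F_int : (\int[lebesgue_measure]_(tau in `[0%R, +oo[) (F tau)%:E = +oo)%E)
  (ustar lambda1 : R)
  (ustar_gt0 : 0 < ustar)
  (lambda1_gt0 : 0 < lambda1) (lambda1_ge : c1 / c0 <= lambda1)
  (tF tL : R) (Fcal Lamt : R -> R)
  (Fcal_cont : {within [set t : R | tF <= t], continuous Fcal})
  (Lamt_cont : {within [set t : R | tL <= t], continuous Lamt})
  (Fcal_incr : forall s t : R, tF <= s -> s <= t -> Fcal s <= Fcal t)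
  (Fcal_ge : \forall t \near +oo,
     (\int[lebesgue_measure]_(tau in `[0%R, t]) F tau)%R <= Fcal t)
  (Lamt_decr : forall s t : R, tL <= s -> s <= t -> Lamt t <= Lamt s)
  (Lamt_ge : \forall t \near +oo,
     sup [set `|g p.1 p.2 - ustar| |
            p in boundary U `*` [set tau : R | t <= tau <= t + 1]]
     + (\int[lebesgue_measure]_(tau in `[t, (t + 1)%R])
          (F tau * Fcal tau `^ lambda1))%R
     <= Lamt t)
  (hZ : forall mu : R, 0 < mu ->
     let z0 := fun t : R => mu * bbar t * Fcal t `^ gamma0 in
     let Lbar := fun t : R => Lamt (t / 4) in
     condZ (diam U) c0
       [set t : R | [/\ tF <= t, 0 <= t & 0 <= Fcal t]] z0
       [set t : R | tL <= t / 4] Lbar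
     /\ limf_esup (fun t => (Lbar t * expR (diam U / c0 * z0 t))%:E) +oo
        = 0%E)
  (m : R) (m_gt0 : 0 < m)
  (u_ge_m : forall x t, ccyl U (x, t) -> m <= u x t) :
  sup [set `|u x t - ustar| | x in closure U] @[t --> +oo] --> (0 : R).
Proof.
have U_bnd := U_bounded.
have u_pos' x t : ccyl U (x, t) -> 0 < u x t.
  by move=> xt; exact: lt_le_trans (u_ge_m _ _ xt).
have sol : log_solution U A K B c0 c1 c2 u f by split.
pose i : 'I_n := Ordinal hn.
have [x' Ux'] := U_neq0.
have Ux'c : closure U x' := subset_closure Ux'.
pose d := diam U.
have d_ge0 : 0 <= d by have := coord_le_diam i U_bnd Ux'c Ux'c; rewrite subrr.
(* An extreme point of the closure in direction [i] provides the origin [l] of the barriers, and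
   [diam U] bounds the width seen from it. *)
have [xl Uxl xl_min] : exists2 xl, closure U xl & forall x, closure U x -> xl i 0 <= x i 0.
  have cpt := compact_closure U_bnd.
  have cC : {within closure U, continuous (fun x : 'cV[R]_n => x i 0)}.
    by apply: continuous_subspaceT; exact: coord_continuous.
  have [|c] := compact_EVT_min _ cpt cC; first by exists x'.
  rewrite inE => Uc cmin; exists c => // x Ux; apply: cmin; exact: mem_set.
have l_bnd x : closure U x -> xl i 0 <= x i 0 /\ x i 0 - xl i 0 <= d.
  by move=> Ux; split; [exact: xl_min|exact: coord_le_diam].
have [T1 T1_ge0 [tFT1 T1Fcal]] : exists2 T1 : R, 0 <= T1 &
    tF <= T1 /\ forall t, T1 <= t -> 0 <= Fcal t.
  have [[_ [_ [T [ts [eps [[T0 _ _ TD _] _]]]]]] _] := hZ 1 ltr01.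
  exists T => //; have [tFT _ _] := TD T (lexx T); split=> // t Tt.
  by have [_ _] := TD t Tt.
have [T2 T2P] : exists T2 : R, forall t, T2 <= t -> 0 <= Lamt t.
  have [[_ [Lge0 [T [ts [eps [[T0 _ _ _ tsD] _]]]]]] _] := hZ 1 ltr01.
  (* The function in [condZ] is [Lamt] at a quarter of the time, so nonnegativity is recovered from
     a quarter of its starting time. *)
  exists (ts / 4) => t; rewrite ler_pdivrMr// => tst.
  have := Lge0 (t * 4) (tsD _ tst).
  by rewrite mulfK// pnatr_eq0.
have Lamt_small mu0 e : 0 < mu0 -> 0 < e -> exists N, forall t, N <= t ->
    Lamt (t / 4) * expR (d / c0 * (mu0 * bbar t * Fcal t `^ gamma0)) < e.
  by move=> m0 e0; have [_ L0] := hZ mu0 m0; exact: limf_esup0_lt L0 e0.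
have [T3 T3P] : exists T3 : R, forall t, T3 <= t ->
    \int[@lebesgue_measure R]_(tau in `[0, t]) F tau <= Fcal t.
  have [N [_ NP]] := Fcal_ge; exists (N + 1) => t Nt; apply: NP.
  by apply: lt_le_trans Nt; rewrite ltrDl.
have [T4 T4P] : exists T4 : R, forall t, T4 <= t ->
    sup [set `|g p.1 p.2 - ustar| |
            p in boundary U `*` [set tau : R | t <= tau <= t + 1]]
     + \int[@lebesgue_measure R]_(tau in `[t, (t + 1)%R]) (F tau * Fcal tau `^ lambda1)
     <= Lamt t.
  have [N [_ NP]] := Lamt_ge; exists (N + 1) => t Nt; apply: NP.
  by apply: lt_le_trans Nt; rewrite ltrDl.
have FC (b c : R) : 0 <= b -> {within `[b, c], continuous F}.
  move=> b0; apply: continuous_subspaceW F_cont => s /=; rewrite in_itv/= => /andP[bs _].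
  exact: le_trans bs.
(* [Fcal] dominates the divergent integral of [F]; being at least 1, it can absorb additive
   constants. *)
have [T5 T5P] : exists T5 : R, forall t, T5 <= t -> 1 <= Fcal t.
  have F_meas : measurable_fun `[0 : R, +oo[ F.
    apply: measurable_realfun.subspace_continuous_measurable_fun => //.
    by apply: continuous_subspaceW F_cont => s /=; rewrite in_itv/= andbT.
  have F_integrable b : (@lebesgue_measure R).-integrable `[0, b] (EFin \o F).
    by apply: continuous_compact_integrable; [exact: segment_compact|exact: FC].
  have [N NP] := integral_unbounded 1 (lexx 0) F_meas F_ge0 F_integrable F_int.
  exists (Num.max N T3) => t; rewrite ge_max => /andP[Nt T3t].
  exact: le_trans (NP _ Nt) (T3P _ T3t).
have max_le (s1 s2 t : R) : Num.max s1 s2 <= t -> s1 <= t /\ s2 <= t.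
  by rewrite ge_max => /andP[].
pose T6 := Num.max 1 (Num.max T1 (Num.max T2 (Num.max T3 (Num.max T4 (Num.max T5 tL))))).
have T6P t : T6 <= t -> [/\ 1 <= t, T1 <= t, T2 <= t & T3 <= t] /\
    [/\ T4 <= t, T5 <= t & tL <= t].
  by move=> /max_le[? /max_le[? /max_le[? /max_le[? /max_le[? /max_le[? ?]]]]]].
have T6_ge1 : 1 <= T6 by rewrite le_max lexx.
have g_bnd x t : boundary U x -> T6 <= t -> `|u x t - ustar| <= Lamt t.
  move=> bx Tt; have [[t1 tT1 tT2 tT3] [tT4 tT5 ttL]] := T6P _ Tt.
  have t0 : 0 < t by exact: lt_le_trans t1.
  apply: le_trans (T4P _ tT4); rewrite -[leLHS]addr0 lerD//; last first.
    apply: Rintegral_ge0 => s /=; rewrite in_itv/= => /andP[ts _].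
    by rewrite mulr_ge0 ?powR_ge0// F_ge0// (le_trans (ltW t0)).
  have idC (s : R) : 0 < s -> {for s, continuous (@id R)} by move=> _; exact: cvg_id.
  (* The set under [sup] must be bounded above: on the boundary [g] equals [u], which is bounded on
     compact time intervals. *)
  have [M M0 MP] := bounded_on_slab (t + 1) U_bnd u_cont u_pos' idC (ltW t0).
  apply: ub_le_sup.
    exists (M + `|ustar|) => _ [[y s] [/= by_ /andP[ts st]] <-] /=.
    apply: (le_trans (ler_normB _ _)); rewrite lerD2r -u_bdry//; last exact: lt_le_trans ts.
    by apply: MP => //; case: by_.
  exists (x, t); last by rewrite /= u_bdry.
  by split=> //=; rewrite lexx lerDl ler01.
have F_bnd t : T6 <= t ->
    \int[@lebesgue_measure R]_(tau in `[t, (t + 1)%R]) (F tau * Fcal tau `^ lambda1) <= Lamt t.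
  move=> Tt; have [[t1 tT1 tT2 tT3] [tT4 tT5 ttL]] := T6P _ Tt.
  apply: le_trans (T4P _ tT4); rewrite lerDr.
  by apply: sup_nneg => _ [p _ <-]; exact: normr_ge0.
have [C1 C1_ge1 C1P] : exists2 C1, 1 <= C1 & forall x t, closure U x -> T6 <= t ->
    1 + u x t <= C1 * Fcal t.
  have idC (s : R) : 0 < s -> {for s, continuous (@id R)} by move=> _; exact: cvg_id.
  have T60 : 0 <= T6 by exact: le_trans T6_ge1.
  have [M M0 MP] := bounded_on_slab T6 U_bnd u_cont u_pos' idC T60.
  pose C := M + (`|ustar| + `|Lamt T6|).
  have C0 : 0 <= C by rewrite /C !addr_ge0.
  (* From [u <= C + 1 + int F] one gets [1 + u <= C + 2 + Fcal], at most [(C + 3) Fcal] because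
     [Fcal >= 1]. *)
  exists (C + 3) => [|x t Ux Tt]; first by lra.
  have [[t1 tT1 tT2 tT3] [tT4 tT5 ttL]] := T6P _ Tt.
  have := @sup_growth _ _ _ _ _ _ _ _ _ _ _ F i T6 C sol (lt_le_trans ltr01 T6_ge1)
    F_cont F_ge0 f_bnd _ _ x t Ux Tt.
  have initC y : closure U y -> u y T6 <= C.
    move=> Uy; have := MP y T6 Uy (lexx _) (lexx _); have := ler_norm (u y T6).
    rewrite /C; have := normr_ge0 ustar; have := normr_ge0 (Lamt T6); lra.
  have bdryC y s : boundary U y -> T6 <= s -> u y s <= C.
    move=> by_ Ts; have := g_bnd _ _ by_ Ts; have := ler_norm (u y s - ustar).
    have [_ [_ _ tLT]] := T6P _ (lexx T6).
    have := Lamt_decr _ _ tLT Ts; have := ler_norm (Lamt T6); have := ler_norm ustar.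
    rewrite /C; lra.
  move=> /(_ initC bdryC) uC.
  have := T3P _ tT3; have := T5P _ tT5; move: uC.
  move: (\int[@lebesgue_measure R]_(_ in _) _)%R => J uC F1 JF.
  have : 0 <= C * (Fcal t - 1) by rewrite mulr_ge0// subr_ge0.
  lra.
have Zint mu : 0 < mu -> exists T,
    [/\ 0 <= T, tF <= T, forall t, T <= t -> 0 <= Fcal t &
     (\int[@lebesgue_measure R]_(x in `[T, +oo[)
        (expR (- (d / c0 * (mu * bbar x * Fcal x `^ gamma0))))%:E = +oo)%E].
  move=> mu0; have [[_ [_ [T [ts [eps [[T0 _ _ TD _] [Tint _]]]]]]] _] := hZ mu mu0.
  exists T; split => //; first by have [] := TD T (lexx T).
  by move=> t Tt; have [] := TD t Tt.
have [[_ tT1 tT2 tT3] [tT4 tT5 ttL]] := T6P _ (lexx T6).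
have limsup p Cg := @power_limsup _ _ _ _ _ _ _ _ _ _ _ F bbar Fcal Lamt i gamma0
  lambda1 ustar T6 tF (xl i 0) d C1 sol gamma0_gt0 ustar_gt0 T6_ge1 d_ge0 C1_ge1
  (le_trans tFT1 tT1) bbar_cont bbar_ge0 bbar_incr B_bnd F_cont F_ge0 f_bnd Fcal_cont
  Fcal_incr (fun t Tt => T5P _ (le_trans tT5 Tt)) C1P l_bnd
  (fun s t Ts => Lamt_decr s t (le_trans ttL Ts)) (fun t Tt => T2P t (le_trans tT2 Tt))
  g_bnd F_bnd Lamt_small Zint p Cg.
have l1c : 0 <= lambda1 * c0 - c1 by rewrite subr_ge0 -ler_pdivrMr.
have upper e : 0 < e -> exists N, forall x t, closure U x -> N <= t -> u x t <= ustar + e.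
  move=> e0; pose p := lambda1 + 1.
  have p0 : 0 < p by rewrite addr_gt0.
  have pE : p - 1 = lambda1 by rewrite addrK.
  (* The tolerance for the power is chosen so that strict monotonicity returns the tolerance [e] for
     [u] itself. *)
  pose e' := (ustar + e) `^ p - ustar `^ p.
  have e'0 : 0 < e'.
    by rewrite subr_gt0 gt0_ltr_powR ?nnegrE ?addr_ge0 ?ltrDl// ltW.
  have [||||x t Ux Tt|N NP] := limsup p (p * C1 `^ lambda1) _ _ _ _ _ e' e'0.
  - by rewrite pE mulr_ge0// ltW.
  - by rewrite pE mulr_ge0// ltW.
  - by rewrite pE !mulr_ge0// ?addr_ge0// ?mulr_ge0// ltW.
  - by rewrite mulr_ge0 ?powR_ge0// ltW.
  - have Uxc := subset_closure Ux.
    have F1 : 0 <= Fcal t by apply: (le_trans ler01); apply: T5P; exact: le_trans Tt.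
    have u1 : 0 < u x t.
      apply: u_pos; split => //=; apply: lt_le_trans Tt; exact: lt_le_trans T6_ge1.
    rewrite pE ger0_norm ?mulr_ge0 ?powR_ge0 ?(ltW p0)// -mulrA ler_wpM2l ?(ltW p0)//.
    rewrite -powRM ?(le_trans ler01 C1_ge1)//; apply: ge0_ler_powR.
    + exact: ltW.
    + by rewrite nnegrE ltW.
    + by rewrite nnegrE mulr_ge0// (le_trans ler01 C1_ge1).
    + by apply: le_trans (C1P _ _ Uxc Tt); rewrite lerDr.
  exists N => x t Ux Nt; rewrite leNgt; apply/negP => ue.
  have := NP x t Ux Nt; rewrite /e' addrC subrK leNgt => /negP; apply.
  have ue0 : 0 <= ustar + e by rewrite addr_ge0 ?ltW.
  by apply: gt0_ltr_powR; rewrite ?nnegrE// (le_trans ue0)// ltW.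
have lower e : 0 < e -> exists N, forall x t, closure U x -> N <= t -> ustar - e <= u x t.
  (* When [e >= ustar], positivity of [u] suffices; otherwise [ustar - e] is a legitimate base for a
     negative power. *)
  move=> e0; have [ee|ee] := leP ustar e.
    exists 0 => x t Ux t0; apply: (@le_trans _ _ 0); first by rewrite subr_le0.
    by apply: ltW; apply: u_pos'; split.
  pose q := c2 / c0 + 1; have q0 : 0 < q by rewrite ltr_wpDl// divr_ge0// ltW.
  have q_ge0 := ltW q0; have c0_ge0 := ltW c0_gt0.
  have qc : q * c0 = c2 + c0 by rewrite mulrDl mul1r divfK// gt_eqF.
  pose e' := (ustar - e) `^ (- q) - ustar `^ (- q).
  have ue0 : 0 < ustar - e by rewrite subr_gt0.
  have powRN_lt (a b : R) : 0 < a -> a < b -> b `^ (- q) < a `^ (- q).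
    move=> a0 ab; rewrite !powRN ltf_pV2 ?posrE ?powR_gt0//; last exact: lt_trans ab.
    by apply: gt0_ltr_powR; rewrite ?nnegrE ?ltW//; exact: lt_trans ab.
  have e'0 : 0 < e' by rewrite subr_gt0 powRN_lt// gtrBl.
  (* Since [u >= m], the factor [u^(-q-1)] is at most [m^(-q-1)], and [Fcal^lambda1 >= 1] brings
     this constant to the required form. *)
  have [||||x t Ux Tt|N NP] := limsup (- q) (q * m `^ (- q - 1)) _ _ _ _ _ e' e'0.
  - have -> : - q * (- q - 1) = q * (q + 1) by ring.
    by rewrite mulr_ge0// addr_ge0.
  - have -> : - q * ((- q - 1) * c0 - c1) = q * (q * c0 + c0 + c1) by ring.
    by rewrite mulr_ge0// addr_ge0// addr_ge0// mulr_ge0.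
  - have -> : - q * ((- q - 1) * c0 + c2) = q * (q * c0 + c0 - c2) by ring.
    by rewrite qc mulr_ge0 ?(ltW q0)//; have := c0_gt0; lra.
  - by rewrite mulr_ge0 ?powR_ge0// ltW.
  - have Uxc := subset_closure Ux.
    have t0 : 0 < t by apply: lt_le_trans Tt; exact: lt_le_trans T6_ge1.
    have um : m <= u x t by apply: u_ge_m; split => //=; exact: ltW.
    rewrite mulNr normrN ger0_norm ?mulr_ge0 ?powR_ge0 ?(ltW q0)//.
    rewrite -mulrA ler_wpM2l ?(ltW q0)//.
    have F1 : 1 <= Fcal t `^ lambda1.
      have <- : 1 `^ lambda1 = 1 :> R by rewrite powR1.
      apply: ge0_ler_powR; rewrite ?nnegrE ?(ltW lambda1_gt0)//.
        by apply: (le_trans ler01); apply: T5P; exact: le_trans Tt.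
      by apply: T5P; exact: le_trans Tt.
    have um2 : u x t `^ (- q - 1) <= m `^ (- q - 1).
      rewrite -opprD !powRN lef_pV2 ?posrE ?powR_gt0 ?(lt_le_trans m_gt0 um)//.
      apply: (ge0_ler_powR _ _ _ um).
      + by rewrite addr_ge0.
      + by rewrite nnegrE ltW.
      + by rewrite nnegrE (le_trans (ltW m_gt0)).
    by apply: (le_trans um2); rewrite ler_peMr ?powR_ge0.
  exists (Num.max 0 N) => x t Ux; rewrite ge_max => /andP[t0 Nt].
  rewrite leNgt; apply/negP => ue.
  have u1 : 0 < u x t by apply: u_pos'; split.
  have := NP x t Ux Nt; rewrite /e' addrC subrK leNgt => /negP; apply.
  exact: powRN_lt.
apply/cvgrPdist_le => e e0.
have [N1 N1P] := upper e e0; have [N2 N2P] := lower e e0.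
near=> t.
have N1t : N1 <= t by near: t; exact: (nbhs_pinfty_ge (num_real N1)).
have N2t : N2 <= t by near: t; exact: (nbhs_pinfty_ge (num_real N2)).
have dist x : closure U x -> `|u x t - ustar| <= e.
  by move=> Ux; rewrite ler_distlC; have := N1P x t Ux N1t; have := N2P x t Ux N2t; lra.
rewrite sub0r normrN ger0_norm; last first.
  by apply: sup_nneg => _ [x _ <-]; exact: normr_ge0.
apply: ge_sup; first by exists `|u x' t - ustar|, x'.
by move=> _ [x Ux <-]; exact: dist.
Unshelve. all: by end_near. Qed.
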